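(* Let $(A,\mathfrak{m})$ be any Noetherian local ring with $k=A/\mathfrak{m}$ algebraically closed, let $d=\dim A$, and let $I$ be an integrally closed $\mathfrak{m}$-primary ideal of $A$. Then there is a one-to-one correspondence between the set of integrally closed ideals $I'$ of $A$ with $I\supset I'$ and $l_A(I/I')=1$, and the set of closed points of $\mathrm{Proj}\left(\bigoplus_{n\ge 0} I^n/\mathfrak{m}I^n\right)$. In particular, the set of such ideals $I'$ forms an algebraic variety of dimension $d-1$.
   Context: $l_A(M)$ denotes the length of an $A$-module $M$. The ring $R=\bigoplus_{n\ge 0} I^n/\mathfrak{m}I^n$ is the fiber cone of $I$, a standard graded $k$-algebra generated over $R_0=k$ by $V=R_1=I/\mathfrak{m}I$; write $R=S/\mathfrak{a}$, where $S=S_k(V)$ is the symmetric algebra of $V$ over $k$ and $\mathfrak{a}$ is a homogeneous ideal. The correspondence meant is the natural one: an ideal $I'\subset I$ with $l_A(I/I')=1$ contains $\mathfrak{m}I$ and so is determined by the codimension-one $k$-subspace $W=I'/\mathfrak{m}I\subset V$, while the closed points of $\mathrm{Proj}(R)$ are identified with the codimension-one subspaces $W\subset V$ such that $WS\supset\mathfrak{a}$; the ideal $I'$ corresponds to the closed point given by $W$. ''Forms an algebraic variety of dimension $d-1$'' means that, through this correspondence, the set of such ideals is identified with the set of closed points of the projective $k$-scheme $\mathrm{Proj}(R)$ (not necessarily irreducible or reduced), which has dimension $d-1$ (the empty scheme having dimension $-1$). *)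

(* Defs.v *)
From HB Require Import structures.
From mathcomp Require Import all_boot all_order all_algebra.
From mathcomp Require Import all_classical.
From mathcomp Require Import topology.
From mathcomp Require Import ring_quotient generic_quotient.

Set Implicit Arguments.
Unset Strict Implicit.
Unset Printing Implicit Defensive.

Import Order.TTheory GRing.Theory Num.Theory.
Local Open Scope classical_set_scope.
Local Open Scope ring_scope.
Local Open Scope quotient_scope.

(* The longest strict chain Z_0 < ... < Z_e of members of F has length e;
   e = -1 when F is empty. *)
Definition longest_chain (T : Type) (F : set (set T)) (e : int) : Prop :=
  -1 <= e /\
  forall n : nat,
    (exists Z : nat -> set T,
       (forall i, (i <= n)%N -> F (Z i)) /\
       (forall i, (i < n)%N -> Z i `<` Z i.+1)) <-> n%:Z <= e.

Definition irreducible_set (X : topologicalType) (Z : set X) : Prop :=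
  Z !=set0 /\
  forall C D : set X, closed C -> closed D ->
    Z `<=` C `|` D -> Z `<=` C \/ Z `<=` D.

Definition top_dim (X : topologicalType) (e : int) : Prop :=
  longest_chain [set Z : set X | closed Z /\ irreducible_set Z] e.

Section Modules.
Variable A : comNzRingType.

Definition module_length (M : lmodType A) (n : nat) : Prop :=
  longest_chain [set Q : set M | submod_closed (mem Q)] n%:Z.

End Modules.

Section Ideals.
Variable A : comNzRingType.

Definition ideal_span (X : set A) : set A :=
  [set x | exists n (c y : 'I_n -> A),
     (forall i, X (y i)) /\ x = \sum_(i < n) c i * y i].

Definition ideal_mul (X Y : set A) : set A :=
  ideal_span [set x * y | x in X & y in Y].

Definition ideal_pow (X : set A) (n : nat) : set A :=
  iter n (ideal_mul X) setT.

Definition noetherian : Prop :=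
  forall J : idealr A, exists s : seq A, [set` J] = ideal_span [set` s].

Definition maximal_ideal (J : idealr A) : Prop :=
  forall K : idealr A, {subset J <= K} -> {subset K <= J}.

Definition local_with (m : idealr A) : Prop :=
  maximal_ideal m /\ forall J : idealr A, maximal_ideal J -> J =i m.

Definition krull_dim (d : nat) : Prop :=
  longest_chain [set [set` P] | P in [set: prime_idealr A]] d%:Z.

Definition primary_ideal (J : idealr A) : Prop :=
  forall x y, x * y \in J -> x \in J \/ exists n : nat, y ^+ n \in J.

Definition primary_to (m J : idealr A) : Prop :=
  primary_ideal J /\ forall x, x \in m <-> exists n : nat, x ^+ n \in J.

Definition integral_over_ideal (J : set A) (x : A) : Prop :=
  exists (n : nat) (a : nat -> A),
    [/\ (0 < n)%N,
        forall i, (1 <= i <= n)%N -> ideal_pow J i (a i) &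
        x ^+ n + \sum_(1 <= i < n.+1) a i * x ^+ (n - i) = 0].

Definition integrally_closed_ideal (J : idealr A) : Prop :=
  forall x, integral_over_ideal [set` J] x -> x \in J.

Lemma ideal_span_sub X : X `<=` ideal_span X.
Proof.
by move=> x Xx; exists 1, (fun=> 1), (fun=> x); rewrite big_ord1 mul1r.
Qed.

Lemma ideal_span0 X : ideal_span X 0.
Proof. by exists 0, (fun=> 0), (fun=> 0); rewrite big_ord0; split => // -[]. Qed.

Lemma ideal_spanMl X a x : ideal_span X x -> ideal_span X (a * x).
Proof.
move=> [n [c [y [Xy ->]]]]; exists n, (fun i => a * c i), y; split=> //.
by rewrite mulr_sumr; apply: eq_bigr => i _; rewrite mulrA.
Qed.

Lemma ideal_spanN X x : ideal_span X x -> ideal_span X (- x).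
Proof. by rewrite -mulN1r; apply: ideal_spanMl. Qed.

Lemma ideal_spanD X x y : ideal_span X x -> ideal_span X y -> ideal_span X (x + y).
Proof.
move=> [n [c [u [Xu ->]]]] [p [e [v [Xv ->]]]].
exists (n + p), (fun i : 'I_(n + p) => match fintype.split i with inl j => c j | inr j => e j end),
  (fun i : 'I_(n + p) => match fintype.split i with inl j => u j | inr j => v j end); split.
  by move=> i; case: (fintype.split i).
rewrite big_split_ord /=; congr (_ + _); apply: eq_bigr => i _.
  by rewrite (unsplitK (inl i)).
by rewrite (unsplitK (inr i)).
Qed.

Lemma ideal_span_min X Y : X `<=` Y -> Y 0 ->
  (forall x y, Y x -> Y y -> Y (x + y)) -> (forall a x, Y x -> Y (a * x)) ->
  ideal_span X `<=` Y.
Proof.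
move=> XY Y0 YD YM _ [n [c [y [Xy ->]]]].
by elim/big_ind: _ => // i _; apply/YM/XY.
Qed.

Lemma ideal_pow0 X n : ideal_pow X n 0.
Proof. by case: n => //= n; apply: ideal_span0. Qed.

Lemma ideal_powD X n x y :
  ideal_pow X n x -> ideal_pow X n y -> ideal_pow X n (x + y).
Proof. by case: n => //= n; apply: ideal_spanD. Qed.

Lemma ideal_powMl X n a x : ideal_pow X n x -> ideal_pow X n (a * x).
Proof. by case: n => //= n; apply: ideal_spanMl. Qed.

Lemma ideal_powN X n x : ideal_pow X n x -> ideal_pow X n (- x).
Proof. by rewrite -mulN1r; apply: ideal_powMl. Qed.

Lemma ideal_mul_mem X Y x y : X x -> Y y -> ideal_mul X Y (x * y).
Proof. by move=> Xx Yy; apply: ideal_span_sub; exists x => //; exists y. Qed.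

Lemma ideal_pow_mul X i j x y :
  ideal_pow X i x -> ideal_pow X j y -> ideal_pow X (i + j) (x * y).
Proof.
elim: i x => [|i IH] x; first by move=> _; apply: ideal_powMl.
move=> Px Pj; move: x Px; apply: ideal_span_min.
- move=> _ [u Xu [v Pv <-]]; rewrite -mulrA; apply: ideal_mul_mem => //.
  exact: IH.
- by rewrite mul0r; apply: ideal_span0.
- by move=> u v Pu Pv; rewrite mulrDl; apply: ideal_spanD.
- by move=> a u Pu; rewrite -mulrA; apply: ideal_spanMl.
Qed.

(* I / I', built as the quotient of the A-module I by its submodule I :&: I'. *)
Section IdealQuotient.
Variables I I' : idealr A.

Definition ideal_pred : {pred A^o} := fun x => x \in I.

Lemma ideal_pred_closed : submod_closed ideal_pred.
Proof.
split; first exact: idealr0.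
by move=> a x y xI yI; apply: (rpredD (S := I)) => //; apply: idealMr.
Qed.

HB.instance Definition _ :=
  GRing.isSubmodClosed.Build A A^o ideal_pred ideal_pred_closed.

Record ideal_mod := IdealMod { ideal_val : A^o; _ : ideal_val \in ideal_pred }.

HB.instance Definition _ := [isSub of ideal_mod for ideal_val].
HB.instance Definition _ := [Choice of ideal_mod by <:].
HB.instance Definition _ := [SubChoice_isSubLmodule of ideal_mod by <:].

Definition sub_ideal_pred : {pred ideal_mod} := fun x => (val x : A) \in I'.

Lemma sub_ideal_predB : zmod_closed sub_ideal_pred.
Proof.
split; first by rewrite unfold_in /sub_ideal_pred raddf0 (rpred0 I').
move=> x y xI yI; rewrite unfold_in /sub_ideal_pred raddfB.
exact: (rpredB (S := I')).
Qed.

HB.instance Definition _ :=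
  GRing.isZmodClosed.Build ideal_mod sub_ideal_pred sub_ideal_predB.

Definition ideal_quotient : Type := Quotient.quot sub_ideal_pred.
HB.instance Definition _ := GRing.Zmodule.on ideal_quotient.

Definition iq_pi (x : ideal_mod) : ideal_quotient :=
  \pi_(Quotient.quot sub_ideal_pred) x.

Definition iq_scale (a : A) (x : ideal_quotient) : ideal_quotient :=
  iq_pi (a *: repr (x : Quotient.quot sub_ideal_pred)).

Lemma iq_piD : {morph iq_pi : x y / x + y}.
Proof. by move=> x y; rewrite /iq_pi raddfD. Qed.

Lemma iq_pi_eq x y : iq_pi x = iq_pi y <-> x - y \in sub_ideal_pred.
Proof. by rewrite Quotient.idealrBE; split=> [e|/eqP]; [apply/eqP|]. Qed.

Lemma iq_piK (x : ideal_quotient) :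
  iq_pi (repr (x : Quotient.quot sub_ideal_pred)) = x.
Proof. by rewrite /iq_pi reprK. Qed.

Lemma iq_piZ a x : iq_scale a (iq_pi x) = iq_pi (a *: x).
Proof.
apply/iq_pi_eq; rewrite -scalerBr unfold_in /sub_ideal_pred linearZ.
by apply: idealMr; apply/iq_pi_eq; rewrite iq_piK.
Qed.

Lemma iq_scaleA a b x : iq_scale a (iq_scale b x) = iq_scale (a * b) x.
Proof. by rewrite -[x]iq_piK !iq_piZ scalerA. Qed.

Lemma iq_scale1 : left_id 1 iq_scale.
Proof. by move=> x; rewrite -[x]iq_piK iq_piZ scale1r. Qed.

Lemma iq_scaleDr : right_distributive iq_scale +%R.
Proof.
move=> a x y; rewrite -[x]iq_piK -[y]iq_piK.
by rewrite -iq_piD !iq_piZ -iq_piD scalerDr.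
Qed.

Lemma iq_scaleDl x : {morph iq_scale^~ x : a b / a + b}.
Proof. by move=> a b; rewrite -[x]iq_piK !iq_piZ -iq_piD scalerDl. Qed.

HB.instance Definition _ := GRing.Zmodule_isLmodule.Build A ideal_quotient
  iq_scaleA iq_scale1 iq_scaleDr iq_scaleDl.

End IdealQuotient.
End Ideals.

Record gradedRing := GradedRing {
  gr_ring :> comNzRingType;
  gr_part : nat -> set gr_ring;
  gr_partB : forall n, zmod_closed (mem (gr_part n));
  gr_part1 : gr_part 0 1;
  gr_partM : forall i j x y,
    gr_part i x -> gr_part j y -> gr_part (i + j) (x * y);
  gr_decomp : forall x, exists n (c : nat -> gr_ring),
    (forall i, gr_part i (c i)) /\ x = \sum_(i < n) c i;
  gr_free : forall n (c : nat -> gr_ring),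
    (forall i, gr_part i (c i)) -> \sum_(i < n) c i = 0 ->
    forall i, (i < n)%N -> c i = 0
}.

Section Proj.
Variable R : gradedRing.

Definition homogeneous (x : R) : Prop := exists n, gr_part n x.

Definition homogeneous_ideal (P : idealr R) : Prop :=
  forall x, x \in P -> exists n (c : nat -> R),
    (forall i, gr_part i (c i) /\ c i \in P) /\ x = \sum_(i < n) c i.

Record Proj := MkProj {
  proj_ideal :> prime_idealr R;
  proj_homogeneous : homogeneous_ideal proj_ideal;
  proj_relevant : exists n x,
    [/\ (0 < n)%N, gr_part n x & (x : R) \notin proj_ideal]
}.

HB.instance Definition _ := gen_eqMixin Proj.
HB.instance Definition _ := gen_choiceMixin Proj.

Definition proj_zeros (E : set R) : set Proj :=
  [set P : Proj | E `<=` [set` (P : prime_idealr R)]].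

Definition proj_open : set (set Proj) :=
  [set U | exists2 E : set R, E `<=` homogeneous & U = ~` proj_zeros E].

Lemma proj_openT : proj_open setT.
Proof.
exists [set 1]; first by move=> _ ->; exists 0; apply: gr_part1.
rewrite -[LHS]setC0; congr (~` _); apply/esym; rewrite -subset0 => P /(_ 1 erefl) /=.
by rewrite idealr1.
Qed.

Lemma proj_openI : setI_closed proj_open.
Proof.
move=> _ _ [E hE ->] [F hF ->].
exists [set x * y | x in E & y in F].
  move=> _ [x /hE[i xi] [y /hF[j yj] <-]]; exists (i + j)%N.
  exact: gr_partM.
rewrite -setCU; congr (~` _); apply/seteqP; split=> P /=.
  case=> PE _ [x Ex [y Fy <-]] /=.
    by rewrite mulrC; apply: idealMr; apply: PE.
  by apply: idealMr; apply: PE.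
move=> PEF; apply: contrapT => /not_orP[].
move=> /existsNP[x /not_implyP[Ex xP]] /existsNP[y /not_implyP[Fy yP]].
have /= : [set` (P : prime_idealr R)] (x * y) by apply: PEF; exists x => //; exists y.
by rewrite prime_idealrM => /orP[].
Qed.

Lemma proj_open_bigU (I : Type) (f : I -> set Proj) :
  (forall i, proj_open (f i)) -> proj_open (\bigcup_i f i).
Proof.
move=> fo.
have /choice[E hE] : forall i, exists Ei : set R,
    Ei `<=` homogeneous /\ f i = ~` proj_zeros Ei.
  by move=> i; have [Ei ? ?] := fo i; exists Ei.
exists (\bigcup_i E i); first by move=> x [i _ /(hE i).1].
rewrite -[LHS]setCK setC_bigcup; congr (~` _); apply/seteqP; split=> P /=.
  by move=> PE x [i _ Eix]; have := PE i Logic.I; rewrite (hE i).2 setCK; apply.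
by move=> PE i _; rewrite (hE i).2 setCK => x Eix; apply: PE; exists i.
Qed.

HB.instance Definition _ :=
  isOpenTopological.Build Proj proj_openT proj_openI proj_open_bigU.

End Proj.

Section FiberCone.
Variables (A : comNzRingType) (m I : idealr A).

(* The Rees algebra A[It], as a subring of the polynomial ring A[t]. *)
Definition rees_pred : {pred {poly A}} :=
  fun p => `[< forall i, ideal_pow [set` I] i p`_i >].

Lemma rees_predP (p : {poly A}) :
  reflect (forall i, ideal_pow [set` I] i p`_i) (p \in rees_pred).
Proof. exact: asboolP. Qed.

Lemma rees_pred_closed : subring_closed rees_pred.
Proof.
split.
- apply/rees_predP => -[|i] //; rewrite coef1; exact: ideal_pow0.
- move=> p q /rees_predP hp /rees_predP hq; apply/rees_predP => i.
  by rewrite coefB; apply: ideal_powD => //; apply: ideal_powN.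
- move=> p q /rees_predP hp /rees_predP hq; apply/rees_predP => i.
  rewrite coefM; apply: big_ind => [|x y|j _].
  + exact: ideal_pow0.
  + exact: ideal_powD.
  + have ji : (j <= i)%N by rewrite -ltnS.
    by rewrite -[X in ideal_pow _ X](subnKC ji); apply: ideal_pow_mul.
Qed.

HB.instance Definition _ :=
  GRing.isSubringClosed.Build {poly A} rees_pred rees_pred_closed.

Record rees := Rees { rees_val :> {poly A}; _ : rees_val \in rees_pred }.

HB.instance Definition _ := [isSub of rees for rees_val].
HB.instance Definition _ := [Choice of rees by <:].
HB.instance Definition _ := [SubChoice_isSubComNzRing of rees by <:].

(* The ideal of the Rees algebra whose degree i part is m I^i t^i. *)
Definition fiber_pred : {pred rees} :=
  fun p => `[< forall i, ideal_mul [set` m] (ideal_pow [set` I] i) (val p)`_i >].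

Lemma fiber_predP (p : rees) :
  reflect (forall i, ideal_mul [set` m] (ideal_pow [set` I] i) (val p)`_i)
    (p \in fiber_pred).
Proof. exact: asboolP. Qed.

Lemma fiber_pred_closed : idealr_closed fiber_pred.
Proof.
split.
- apply/fiber_predP => i; rewrite raddf0 coef0; exact: ideal_span0.
- apply/negP => /fiber_predP /(_ 0); rewrite rmorph1 coef1 /= => m1.
  suff : 1 \in m by rewrite idealr1.
  move: m1; apply: (@ideal_span_min _ _ [set` m]) => /=.
  + by move=> _ [x xm [y _ <-]]; rewrite mulrC; apply: idealMr.
  + exact: idealr0.
  + by move=> x y; apply: rpredD.
  + by move=> x y; apply: idealMr.
- move=> a p q /fiber_predP hp /fiber_predP hq; apply/fiber_predP => i.
  rewrite (rmorphD \val) (rmorphM \val) coefD coefM; apply: ideal_spanD; last exact: hq.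
  apply: big_ind => [|x y|j _].
  + exact: ideal_span0.
  + exact: ideal_spanD.
  + have ha := rees_predP _ (valP a) j.
    move: (hp (i - j)%N); apply: (@ideal_span_min _ _
      [set z | ideal_mul [set` m] (ideal_pow [set` I] i) ((val a)`_j * z)]) => /=.
    * move=> _ [u um [v Iv <-]]; rewrite /= mulrCA; apply: ideal_mul_mem => //.
      have ji : (j <= i)%N by rewrite -ltnS.
      by rewrite -[X in ideal_pow _ X](subnKC ji); apply: ideal_pow_mul.
    * by rewrite mulr0; apply: ideal_span0.
    * by move=> x y; rewrite mulrDr; apply: ideal_spanD.
    * by move=> b x; rewrite mulrCA; apply: ideal_spanMl.
Qed.

HB.instance Definition _ := isIdealr.Build rees fiber_pred fiber_pred_closed.

Definition fiber_ring : comNzRingType := {ideal_quot fiber_pred}.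

(* The image in the degree n part I^n / m I^n of the elements of X `&` I^n. *)
Definition fiber_form (n : nat) (X : set A) : set fiber_ring :=
  [set \pi_fiber_ring r | r in [set r : rees | exists2 a, X a & val r = a *: 'X^n]].

Definition fiber_part (n : nat) : set fiber_ring := fiber_form n setT.

Lemma fiber_partP n x : fiber_part n x <->
  exists2 r : rees, x = \pi_fiber_ring r & exists a, val r = a *: 'X^n.
Proof.
split=> [[r [a _ ra] <-]|[r -> [a ra]]]; first by exists r => //; exists a.
by exists r => //; exists a.
Qed.

Lemma fiber_partB n : zmod_closed (mem (fiber_part n)).
Proof.
split.
  rewrite inE; apply/fiber_partP; exists 0; first by rewrite raddf0.
  by exists 0; rewrite raddf0 scale0r.
move=> x y; rewrite !inE => /fiber_partP[r -> [a ra]] /fiber_partP[s -> [b sb]].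
apply/fiber_partP; exists (r - s); first by rewrite raddfB.
by exists (a - b); rewrite raddfB /= scalerBl -ra -sb.
Qed.

Lemma fiber_part1 : fiber_part 0 1.
Proof.
apply/fiber_partP; exists 1; first by rewrite rmorph1.
by exists 1; rewrite rmorph1 scale1r.
Qed.

Lemma fiber_partM i j x y :
  fiber_part i x -> fiber_part j y -> fiber_part (i + j) (x * y).
Proof.
move=> /fiber_partP[r -> [a ra]] /fiber_partP[s -> [b sb]].
apply/fiber_partP; exists (r * s); first by rewrite rmorphM.
exists (a * b); rewrite (rmorphM \val) /= (ra : rees_val r = _) (sb : rees_val s = _).
by rewrite -scalerAl -scalerAr scalerA exprD.
Qed.

Lemma rees_monomial (r : rees) i : (val r)`_i *: 'X^i \in rees_pred.
Proof.
apply/rees_predP => j; rewrite coefZ coefXn; case: eqP => [->|_].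
  by rewrite mulr1; apply/rees_predP/(valP r).
by rewrite mulr0; apply: ideal_pow0.
Qed.

Lemma fiber_decomp (x : fiber_ring) : exists n (c : nat -> fiber_ring),
  (forall i, fiber_part i (c i)) /\ x = \sum_(i < n) c i.
Proof.
pose r : rees := repr x.
exists (size (val r)), (fun i => \pi_fiber_ring (Rees (rees_monomial r i))); split.
  by move=> i; apply/fiber_partP; exists (Rees (rees_monomial r i)) => //; exists (val r)`_i.
rewrite -raddf_sum -[LHS]reprK; congr (\pi_fiber_ring _); apply: val_inj.
rewrite (raddf_sum \val) /= -[LHS]coefK poly_def.
by apply: eq_bigr.
Qed.

Lemma fiber_free n (c : nat -> fiber_ring) :
  (forall i, fiber_part i (c i)) -> \sum_(i < n) c i = 0 ->
  forall i, (i < n)%N -> c i = 0.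
Proof.
move=> hc; have /choice[r hr] : forall i, exists r : rees,
    c i = \pi_fiber_ring r /\ exists a, val r = a *: 'X^i.
  by move=> i; have /fiber_partP[r cr ra] := hc i; exists r.
have piE (p : rees) : \pi_fiber_ring p = 0 <-> p \in fiber_pred.
  rewrite -[p in X in _ <-> X]subr0 Quotient.idealrBE -(raddf0 \pi_fiber_ring).
  by split=> [e|/eqP]; [apply/eqP|].
rewrite (eq_bigr (fun i : 'I_n => \pi_fiber_ring (r i))); last by move=> i _; rewrite (hr i).1.
rewrite -raddf_sum => /piE /fiber_predP h i ltin.
rewrite (hr i).1; apply/piE/fiber_predP => j.
have [a ra] := (hr i).2; rewrite ra coefZ coefXn.
case: (eqVneq j i) => [->|_]; last by rewrite mulr0; apply: ideal_span0.
rewrite mulr1; have := h i; rewrite (raddf_sum \val) coef_sum (bigD1 (Ordinal ltin)) //=.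
rewrite big1 ?addr0; first by have /= -> := ra; rewrite coefZ coefXn eqxx mulr1.
move=> k ki; have [b /= ->] := (hr k).2; rewrite coefZ coefXn.
by rewrite eq_sym -val_eqE /= in ki; rewrite (negPf ki) mulr0.
Qed.

Definition fiber_cone : gradedRing :=
  GradedRing fiber_partB fiber_part1 fiber_partM fiber_decomp fiber_free.

(* The ideal WR of R generated by W = I' / mI, i.e. the image of WS in R = S / a. *)
Definition cone_point (I' : idealr A) : set fiber_cone :=
  ideal_span (fiber_form 1 [set` I'] : set fiber_ring).

End FiberCone.

(* Main.v *)
(** Write I = I' + Az for an ideal I' of colength one.  Then R/WR is spanned by the powers
    of the class t of z, and t^n = 0 iff z^n lies in I' I^(n-1), which is an equation of
    integral dependence of z on I'.  So if I' is integrally closed then R/WR is the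
    polynomial ring k[t], and WR is a closed point.  Conversely a closed point P is a maximal
    relevant homogeneous prime; for z in I outside P, R_n = P_n + z R_(n-1) for large n, hence
    every s in R_1 satisfies a monic homogeneous equation over k[z] modulo P, which splits
    into linear factors s - cz; so P_1 has codimension one, and the domain R/P = k[t] forces
    the corresponding ideal to be integrally closed.

    The dimension of Proj(R) is computed by comparing growth of lengths.  A chain of e + 1
    relevant homogeneous primes makes the length of A/I^n grow at least like n^(e+1), while a
    system of parameters x_1, ..., x_d in I bounds it by the length of A/(x_1^n, ..., x_d^n),
    which is O(n^d).  In the other direction, if there are no chains of n + 1 relevant
    primes, homogeneous prime avoidance gives n forms with no common zero; they lift to n
    elements generating an m-primary ideal J, so that A/J^k has length O(k^n), whereas
    (by Artin-Rees) a chain of j + 1 primes of A makes it grow at least like k^j. *)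
From HB Require Import structures.
Require Import Defs.
From mathcomp Require Import all_boot all_order all_algebra.
From mathcomp Require Import all_classical.
From mathcomp Require Import topology.
From mathcomp Require Import ring_quotient generic_quotient.
From mathcomp Require Import zify.

Set Implicit Arguments.
Unset Strict Implicit.
Unset Printing Implicit Defensive.

Import Order.TTheory GRing.Theory Num.Theory.
Local Open Scope classical_set_scope.
Local Open Scope ring_scope.

(** * Chains *)

(** Lengths are never computed as numbers. A lower bound is an explicit chain of ideals of [A], an
    upper bound is a bound on all such chains, and the two are compared only through their exponents
    of growth; no Hilbert polynomial is involved.

    The fiber cone is a quotient of a subring of [A[t]], awkward to compute in. A homogeneous ideal
    is therefore handled as a set of pairs (n, a), standing for the forms a t^n of the Rees algebra,
    so that each graded piece is an ideal of [A] and all chains live in the same lattice. Ideals of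
    [A] and these sets of forms share one abstract treatment of prime decomposition and prime
    avoidance, used on both sides of the dimension count.

    Both exponents come from one mechanism: if f lies in the larger of two consecutive primes but
    not in the smaller, multiplication by f carries chains modulo the smaller one to chains between
    the two, so each inclusion raises the exponent by one. In the graded ring the degree of f is the
    only shift; in the local ring Artin-Rees bounds it. The extra 1 in e + 1 comes from adding up
    consecutive degrees. *)

Inductive chain (T : Type) (r : T -> T -> Prop) (F : set T) : nat -> T -> Prop :=
| chain0 z : F z -> chain r F 0 z
| chainS n z w : chain r F n z -> r z w -> F w -> chain r F n.+1 w.

Lemma chain_top (T : Type) (r : T -> T -> Prop) (F : set T) n z :
  chain r F n z -> F z.
Proof. by case. Qed.

Lemma chain_seq (T : Type) (r : T -> T -> Prop) (F : set T) n z :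
  chain r F n z ->
  exists Z : nat -> T, [/\ forall i, (i <= n)%N -> F (Z i),
    forall i, (i < n)%N -> r (Z i) (Z i.+1) & Z n = z].
Proof.
elim=> [{n}z' Fz|{}n {}z w _ [Z [FZ rZ Zn]] rzw Fw]; first by exists (fun=> z').
exists (fun i => if (i <= n)%N then Z i else w); split=> [i|i|].
- by move=> _; case: (leqP i n) => // /FZ.
- move=> ilen; have [lin|nlei] := ltnP i n; first by rewrite (ltnW lin); apply: rZ.
  by have -> : i = n by [lia]; rewrite leqnn Zn.
- by rewrite ltnn.
Qed.

Lemma chain_of_seq (T : Type) (r : T -> T -> Prop) (F : set T) n (Z : nat -> T) :
  (forall i, (i <= n)%N -> F (Z i)) -> (forall i, (i < n)%N -> r (Z i) (Z i.+1)) ->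
  chain r F n (Z n).
Proof.
elim: n => [|n IH] FZ rZ; first by apply: chain0; apply: FZ.
apply: (chainS (z := Z n)); [|exact: rZ|exact: FZ].
by apply: IH => i lin; [apply: FZ; apply: leq_trans lin _|apply: rZ; apply: leq_trans lin _].
Qed.

(** Dimensions are counted along ascending chains, while the growth arguments start at the largest
    prime and descend; passing between primes and closed sets also reverses inclusions. *)
Lemma chain_rev (T : Type) (r : T -> T -> Prop) (F : set T) n z :
  chain r F n z -> exists w, chain (fun x y => r y x) F n w.
Proof.
move=> cz; have [Z [FZ rZ _]] := chain_seq cz; exists (Z (n - n)%N).
apply: (@chain_of_seq _ (fun x y => r y x) _ n (fun i => Z (n - i)%N)) => i lin.
  by apply: FZ; rewrite leq_subr.
by rewrite -[X in r _ (Z X)](subnSK lin); apply: rZ; lia.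
Qed.

Lemma chain_map (T T' : Type) (r : T -> T -> Prop) (r' : T' -> T' -> Prop)
    (F : set T) (F' : set T') (f : T -> T') n z :
  (forall x, F x -> F' (f x)) ->
  (forall x y, F x -> F y -> r x y -> r' (f x) (f y)) ->
  chain r F n z -> chain r' F' n (f z).
Proof.
move=> Ff rf; elim=> [w Fw|{}n {}z w cz IH rzw Fw]; first exact/chain0/Ff.
apply: (chainS IH); last exact: Ff.
by apply: rf => //; apply: chain_top cz.
Qed.

Lemma chain_sub (T : Type) (r : T -> T -> Prop) (F F' : set T) n z :
  F `<=` F' -> chain r F n z -> chain r F' n z.
Proof. by move=> FF'; apply: (chain_map (f := id)). Qed.

Lemma chain_pred (T : Type) (r : T -> T -> Prop) (F : set T) n p z :
  (p <= n)%N -> chain r F n z -> exists w, chain r F p w.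
Proof.
move=> pn cz; have [Z [FZ rZ _]] := chain_seq cz; exists (Z p); apply: chain_of_seq => i ip.
  by apply: FZ; apply: leq_trans pn.
by apply: rZ; apply: leq_trans pn.
Qed.

Lemma longest_chainP (T : Type) (F : set (set T)) (e : int) :
  longest_chain F e <->
  -1 <= e /\ forall n : nat, (exists z, chain (@proper T) F n z) <-> n%:Z <= e.
Proof.
have E n : (exists z, chain (@proper T) F n z) <->
  exists Z : nat -> set T, (forall i, (i <= n)%N -> F (Z i)) /\
       (forall i, (i < n)%N -> Z i `<` Z i.+1).
  split=> [[z cz]|[Z [FZ rZ]]]; first by have [Z [? ? _]] := chain_seq cz; exists Z.
  by exists (Z n); apply: chain_of_seq.
by split=> -[e1 h]; split=> // n; [rewrite (E n)|rewrite -(E n)].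
Qed.

(** * Ideals as sets *)

(** Unlike [idealr], this admits the unit ideal, so that sums, colons, powers and chains ending at
    the whole ring stay in one class. *)
Definition is_ideal (A : comNzRingType) (J : set A) : Prop :=
  [/\ J 0, forall x y, J x -> J y -> J (x + y) & forall a x, J x -> J (a * x)].

Definition is_prime (A : comNzRingType) (P : set A) : Prop :=
  [/\ is_ideal P, ~ P 1 & forall x y, P (x * y) -> P x \/ P y].

Definition add_ideal (A : comNzRingType) (J K : set A) : set A :=
  [set x + y | x in J & y in K].

Definition scale_ideal (A : comNzRingType) (a : A) (K : set A) : set A :=
  [set a * x | x in K].

Definition colon (A : comNzRingType) (J : set A) (x : A) : set A :=
  [set a | J (a * x)].

Definition adjoin (A : comNzRingType) (J : set A) (x : A) : set A :=
  add_ideal J (scale_ideal x setT).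

Section IdealSets.
Variable A : comNzRingType.
Implicit Types (J K : set A) (x y : A).

Lemma ideal0 J : is_ideal J -> J 0.
Proof. by case. Qed.

Lemma idealD J x y : is_ideal J -> J x -> J y -> J (x + y).
Proof. by case=> _ + _; apply. Qed.

Lemma idealM J a x : is_ideal J -> J x -> J (a * x).
Proof. by case=> _ _; apply. Qed.

Lemma idealMC J a x : is_ideal J -> J x -> J (x * a).
Proof. by rewrite mulrC; apply: idealM. Qed.

Lemma idealN J x : is_ideal J -> J x -> J (- x).
Proof. by rewrite -mulN1r; apply: idealM. Qed.

Lemma idealB J x y : is_ideal J -> J x -> J y -> J (x - y).
Proof. by move=> idJ Jx Jy; apply: idealD => //; apply: idealN. Qed.

Lemma ideal_sum J (I : Type) (r : seq I) (P : pred I) (f : I -> A) :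
  is_ideal J -> (forall i, P i -> J (f i)) -> J (\sum_(i <- r | P i) f i).
Proof.
move=> idJ Jf; apply: (big_ind J) => //; first exact: ideal0.
by move=> x y; apply: idealD.
Qed.

Lemma idealBE J x y : is_ideal J -> J y -> J (x - y) -> J x.
Proof. by move=> idJ Jy Jxy; rewrite -(subrK y x); apply: idealD. Qed.

Lemma ideal1 J : is_ideal J -> J 1 -> J = setT.
Proof.
move=> idJ J1; apply/seteqP; split=> // x _.
by rewrite -(mulr1 x); apply: idealM.
Qed.

Lemma ideal_span_ideal (X : set A) : is_ideal (ideal_span X).
Proof.
split; first exact: ideal_span0.
  by move=> x y; apply: ideal_spanD.
by move=> a x; apply: ideal_spanMl.
Qed.

Lemma ideal_span_le (X J : set A) : is_ideal J -> X `<=` J -> ideal_span X `<=` J.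
Proof. by case=> J0 JD JM XJ; apply: ideal_span_min. Qed.

Lemma ideal_span_mono (X Y : set A) : X `<=` Y -> ideal_span X `<=` ideal_span Y.
Proof.
move=> XY; apply: ideal_span_le; first exact: ideal_span_ideal.
by move=> x /XY; apply: ideal_span_sub.
Qed.

Lemma setT_ideal : is_ideal (setT : set A).
Proof. by []. Qed.

Lemma setI_ideal J K : is_ideal J -> is_ideal K -> is_ideal (J `&` K).
Proof.
move=> idJ idK; split; first by split; apply: ideal0.
  by move=> x y [? ?] [? ?]; split; apply: idealD.
by move=> a x [? ?]; split; apply: idealM.
Qed.

Lemma ideal_pow_ideal (X : set A) n : is_ideal (ideal_pow X n).
Proof.
split; first exact: ideal_pow0.
  by move=> x y; apply: ideal_powD.
by move=> a x; apply: ideal_powMl.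
Qed.

Lemma ideal_mul_ideal (X Y : set A) : is_ideal (ideal_mul X Y).
Proof. exact: ideal_span_ideal. Qed.

Lemma ideal_mul_le (X Y J : set A) : is_ideal J ->
  (forall x y, X x -> Y y -> J (x * y)) -> ideal_mul X Y `<=` J.
Proof.
by move=> idJ XYJ; apply: ideal_span_le => // _ [x Xx [y Yy <-]]; apply: XYJ.
Qed.

Lemma idealr_ideal (J : idealr A) : is_ideal [set` J].
Proof.
split=> [|x y|a x] /=; [exact: idealr0|exact: (rpredD (S := J))|exact: idealMr].
Qed.

Lemma add_ideal_ideal J K : is_ideal J -> is_ideal K -> is_ideal (add_ideal J K).
Proof.
move=> idJ idK; split.
- by exists 0; [exact: ideal0|exists 0; [exact: ideal0|rewrite addr0]].
- move=> _ _ [x Jx [y Ky <-]] [x' Jx' [y' Ky' <-]].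
  by exists (x + x'); [exact: idealD|exists (y + y'); [exact: idealD|rewrite addrACA]].
- move=> a _ [x Jx [y Ky <-]].
  by exists (a * x); [exact: idealM|exists (a * y); [exact: idealM|rewrite mulrDr]].
Qed.

Lemma scale_ideal_ideal a K : is_ideal K -> is_ideal (scale_ideal a K).
Proof.
move=> idK; split; first by exists 0; [exact: ideal0|rewrite mulr0].
  by move=> _ _ [x Kx <-] [y Ky <-]; exists (x + y); [exact: idealD|rewrite mulrDr].
by move=> b _ [x Kx <-]; exists (b * x); [exact: idealM|rewrite mulrCA].
Qed.

Lemma colon_ideal J x : is_ideal J -> is_ideal (colon J x).
Proof.
move=> idJ; split=> [|a b|a b]; rewrite /colon /=.
- by rewrite mul0r; apply: ideal0.
- by rewrite mulrDl; apply: idealD.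
- by rewrite -mulrA; apply: idealM.
Qed.

Lemma adjoin_ideal J x : is_ideal J -> is_ideal (adjoin J x).
Proof. by move=> idJ; apply: add_ideal_ideal => //; apply: scale_ideal_ideal. Qed.

Lemma sub_add_ideall J K : is_ideal K -> J `<=` add_ideal J K.
Proof. by move=> /ideal0 K0 x Jx; exists x => //; exists 0 => //; rewrite addr0. Qed.

Lemma sub_add_idealr J K : is_ideal J -> K `<=` add_ideal J K.
Proof. by move=> /ideal0 J0 x Kx; exists 0 => //; exists x => //; rewrite add0r. Qed.

Lemma add_ideal_min J K L : is_ideal L -> J `<=` L -> K `<=` L -> add_ideal J K `<=` L.
Proof. by move=> idL JL KL _ [x /JL Lx [y /KL Ly <-]]; apply: idealD. Qed.

Lemma sub_adjoin J x : J `<=` adjoin J x.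
Proof. exact/sub_add_ideall/scale_ideal_ideal. Qed.

Lemma mem_adjoin J x : is_ideal J -> adjoin J x x.
Proof. by move=> idJ; apply: sub_add_idealr => //; exists 1 => //; rewrite mulr1. Qed.

Lemma adjoinP J x w : adjoin J x w <-> exists2 y, J y & exists a, w = y + a * x.
Proof.
split=> [[y Jy [_ [a _ <-] <-]]|[y Jy [a ->]]].
  by exists y => //; exists a; rewrite (mulrC a).
by exists y => //; exists (a * x) => //; exists a => //; rewrite mulrC.
Qed.

Lemma adjoin_min J x L : is_ideal L -> J `<=` L -> L x -> adjoin J x `<=` L.
Proof.
move=> idL JL Lx; apply: add_ideal_min => // _ [a _ <-]; exact: idealMC.
Qed.

Lemma ideal_powS_sub (X : set A) n : ideal_pow X n.+1 `<=` ideal_pow X n.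
Proof.
by apply: ideal_mul_le => [|x y _]; [exact: ideal_pow_ideal|exact: ideal_powMl].
Qed.

Lemma ideal_pow_anti (X : set A) n p : (n <= p)%N -> ideal_pow X p `<=` ideal_pow X n.
Proof.
move=> /subnKC <-; elim: (p - n)%N => [|k IH]; first by rewrite addn0.
by rewrite addnS; apply: subset_trans (ideal_powS_sub (X := X) (n := _)) IH.
Qed.

Lemma ideal_pow1 (X : set A) : is_ideal X -> ideal_pow X 1 = X.
Proof.
move=> idX; apply/seteqP; split; first by apply: ideal_mul_le => // x y Xx _; apply: idealMC.
by move=> x Xx; rewrite -(mulr1 x); apply: ideal_mul_mem.
Qed.

Lemma ideal_pow_exp (X : set A) n x : X x -> ideal_pow X n (x ^+ n).
Proof. by move=> Xx; elim: n => // n IH; rewrite exprS; apply: ideal_mul_mem. Qed.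

Lemma ideal_pow_exp_mul (X : set A) i n x :
  ideal_pow X i x -> ideal_pow X (n * i) (x ^+ n).
Proof.
by move=> Xx; elim: n => // n IH; rewrite exprS mulSn; apply: ideal_pow_mul.
Qed.

Lemma ideal_pow_mono (X Y : set A) n : X `<=` Y -> ideal_pow X n `<=` ideal_pow Y n.
Proof.
move=> XY; elim: n => // n IH; apply: ideal_mul_le; first exact: ideal_pow_ideal.
by move=> x y /XY Yx /IH Yy; apply: ideal_mul_mem.
Qed.

Lemma mk_idealr J : is_ideal J -> ~ J 1 -> exists K : idealr A, [set` K] = J.
Proof.
move=> idJ nJ1; pose f : A -> bool := fun x => `[< J x >].
have cf : idealr_closed f.
  split; first by apply/asboolP; apply: ideal0.
    by apply/negP => /asboolP.
  by move=> a x y /asboolP Jx /asboolP Jy; apply/asboolP; apply: idealD => //; apply: idealM.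
pose Km := isIdealr.Build A f cf.
pose K : idealr A := HB.pack f Km.
exists K; apply/seteqP; split=> x /=; first by move/asboolP.
by move=> Jx; apply/asboolP.
Qed.

Lemma mk_prime P : is_prime P -> exists K : prime_idealr A, [set` K] = P.
Proof.
case=> idP nP1 primeP; pose f : A -> bool := fun x => `[< P x >].
have cf : idealr_closed f.
  split; first by apply/asboolP; apply: ideal0.
    by apply/negP => /asboolP.
  by move=> a x y /asboolP Jx /asboolP Jy; apply/asboolP; apply: idealD => //; apply: idealM.
have pf : prime_idealr_closed f.
  move=> x y /asboolP /primeP[Px|Py]; apply/orP; [left|right]; exact/asboolP.
pose Km := isIdealr.Build A f cf.
pose Kp := isPrimeIdealrClosed.Build A f pf.
pose K : prime_idealr A := HB.pack f Km Kp.
exists K; apply/seteqP; split=> x /=; first by move/asboolP.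
by move=> Jx; apply/asboolP.
Qed.

Lemma prime_idealr_prime (P : prime_idealr A) : is_prime [set` P].
Proof.
split; [exact: idealr_ideal|by rewrite /= idealr1|].
by move=> x y /=; rewrite prime_idealrM => /orP.
Qed.

(** Bundled ideals with the same carrier differ only in proofs, which proof irrelevance identifies.
    The correspondence starts from a set of bundled ideals, so its injectivity rests on this. *)
Lemma idealr_inj (J K : idealr A) : [set` J] = [set` K] -> J = K.
Proof.
case: J K => [f cf] [g cg] /= fg.
have {}fg : f = g.
  apply/funext => x; apply/idP/idP => hx.
    by have : [set` Idealr.Pack cg] x by rewrite -fg.
  by have : [set` Idealr.Pack cf] x by rewrite fg.
move: cg; rewrite -{g}fg => cg; congr Idealr.Pack.
case: cf cg => [[a] [b] [c]] [[a'] [b'] [c']].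
by congr Idealr.Class; [congr GRing.isOppClosed.Axioms_|
  congr GRing.isAddClosed.Axioms_|congr isProperIdeal.Axioms_]; exact: Prop_irrelevance.
Qed.

Lemma prime_idealr_inj (J K : prime_idealr A) :
  [set` J] = [set` K] -> J = K.
Proof.
case: J K => [f cf] [g cg] /= fg.
have {}fg : f = g.
  apply/funext => x; apply/idP/idP => hx.
    by have : [set` PrimeIdealr.Pack cg] x by rewrite -fg.
  by have : [set` PrimeIdealr.Pack cf] x by rewrite fg.
move: cg; rewrite -{g}fg => cg; congr PrimeIdealr.Pack.
case: cf cg => [[a] [b] [c] [d]] [[a'] [b'] [c'] [d']].
by congr PrimeIdealr.Class; [congr GRing.isOppClosed.Axioms_|
  congr GRing.isAddClosed.Axioms_|congr isProperIdeal.Axioms_|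
  congr isPrimeIdealrClosed.Axioms_]; exact: Prop_irrelevance.
Qed.

End IdealSets.
(** * Lengths *)

Definition ideals_above (A : comNzRingType) (K : set A) : set (set A) :=
  [set Z | is_ideal Z /\ K `<=` Z].

Notation ichain K := (chain (@proper _) (ideals_above K)).

(* [M / K] has length at most [l], expressed by chains of ideals of [A] itself. *)
Definition len_le (A : comNzRingType) (K M : set A) (l : nat) : Prop :=
  forall n, ichain K n M -> (n <= l)%N.

(** Inductions run over the list, while [X] keeps the generators set aside, or a base ideal modulo
    which one works. *)
Definition gen (A : comNzRingType) (X : set A) (s : seq A) : set A :=
  ideal_span (X `|` [set` s]).

Section Lengths.
Variable A : comNzRingType.
Implicit Types (J K L M q Z : set A) (x y : A).

Lemma ichain_mono K n L M :
  ichain K n L -> is_ideal M -> L `<=` M -> ichain K n M.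
Proof.
case=> [z [_ Kz]|{}n z w cz [zw nwz] _] idM LM.
  by apply: chain0; split=> //; apply: subset_trans LM.
have zM : z `<=` M by apply: subset_trans LM.
apply: (chainS cz); first by split=> // /(subset_trans LM).
by split=> //; apply: subset_trans zM; case: (chain_top cz).
Qed.

Lemma ichain_cat K L M a b : ichain K a L -> ichain L b M -> ichain K (a + b) M.
Proof.
move=> cK; elim=> [z [idz Lz]|n z w cz IH zw [idw Lw]].
  by rewrite addn0; apply: ichain_mono cK _ _.
rewrite addnS; apply: (chainS IH zw); split=> //.
by apply: subset_trans zw.1; case: (chain_top IH).
Qed.

Lemma ichain1 K L : is_ideal K -> is_ideal L -> K `<` L -> ichain K 1 L.
Proof.
move=> idK idL KL; apply: (chainS (z := K)) => //; last by split=> //; case: KL.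
by apply: chain0; split=> //; apply: subset_refl.
Qed.

(* Multiplication by [a] embeds the lattice of ideals above [q] into that of ideals above [K]. *)
Lemma ichain_scale K q (a : A) n Z : is_ideal K ->
  (forall b, Z b -> K (a * b) -> q b) ->
  ichain q n Z -> ichain K n (add_ideal K (scale_ideal a Z)).
Proof.
move=> idK + cZ; elim: cZ => [z [idz qz]|{}n z w cz IH [zw nwz] [idw qw]] hq.
  by apply: chain0; split; [apply: add_ideal_ideal => //|apply: sub_add_ideall];
    apply: scale_ideal_ideal.
have [idz qz] := chain_top cz.
apply: (chainS (IH (fun b zb => hq b (zw b zb)))).
  split=> [_ [k Kk [_ [b zb <-] <-]]|sub].
    by exists k => //; exists (a * b) => //; exists b => //; apply: zw.
  apply: nwz => x wx.
  have /sub[k Kk [_ [y zy <-] e]] : add_ideal K (scale_ideal a w) (a * x).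
    by apply: sub_add_idealr => //; exists x.
  apply: (idealBE (y := y)) => //; apply: qz; apply: hq.
    by apply: idealB => //; apply: zw.
  by rewrite mulrBr -e addrK.
by split; [apply: add_ideal_ideal => //|apply: sub_add_ideall]; apply: scale_ideal_ideal.
Qed.

(** By the modular law, each strict step of a chain remains strict either after intersecting with
    [L] or after adding [L]. This replaces additivity of length. *)
Lemma ichain_split K L n Z : is_ideal L -> K `<=` L -> ichain K n Z ->
  exists a b, [/\ (n <= a + b)%N, ichain K a (Z `&` L) & ichain L b (add_ideal Z L)].
Proof.
move=> idL KL; elim=> [z [idz Kz]|{}n z w cz [a [b [nab ca cb]]] [zw nwz] [idw Kw]].
  exists 0, 0; split=> //; apply: chain0; split.
  - exact: setI_ideal.
  - by move=> x Kx; split; [apply: Kz|apply: KL].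
  - exact: add_ideal_ideal.
  - exact: sub_add_idealr.
have [idz Kz] := chain_top cz.
have zLwL : z `&` L `<=` w `&` L by move=> x [/zw].
have zLwL' : add_ideal z L `<=` add_ideal w L.
  by move=> _ [x /zw wx [y Ly <-]]; exists x => //; exists y.
have [wLzL|/existsNP[x /not_implyP[wx nzx]]] := pselect (w `&` L `<=` z `&` L).
  exists a, b.+1; split; first by rewrite addnS ltnS.
    by apply: ichain_mono ca _ _ => //; apply: setI_ideal.
  apply: (chainS cb); last by split; [exact: add_ideal_ideal|exact: sub_add_idealr].
  split=> // wLzL'; apply: nwz => x wx.
  have /wLzL'[y zy [t Lt e]] : add_ideal w L x by apply: sub_add_ideall.
  rewrite -e; apply: idealD => //; apply: (wLzL t _).1; split=> //.
  by rewrite -[t](addKr y) e; apply: idealD => //; apply: idealN => //; apply: zw.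
exists a.+1, b; split; first by rewrite addSn ltnS.
  apply: (chainS ca); first by split=> // /(_ x wx).
  split; first exact: setI_ideal.
  by move=> t Kt; split; [apply: Kw|apply: KL].
by apply: ichain_mono cb _ _ => //; apply: add_ideal_ideal.
Qed.

Lemma len_le_cat K L M a b : is_ideal L -> is_ideal M -> K `<=` L -> L `<=` M ->
  len_le K L a -> len_le L M b -> len_le K M (a + b).
Proof.
move=> idL idM KL LM ha hb n /(ichain_split idL KL)[a' [b' [nab ca cb]]].
apply: leq_trans nab _; apply: leq_add.
  by apply/ha/(ichain_mono ca) => // x [].
by apply/hb/(ichain_mono cb) => //; apply: add_ideal_min.
Qed.

Lemma len_le_mono K L M l : K `<=` L -> len_le K M l -> len_le L M l.
Proof.
move=> KL h n c; apply: h; apply: chain_sub c => Z [idZ LZ].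
by split=> //; apply: subset_trans LZ.
Qed.

(** The module (K + Ax)/K is a cyclic quotient of A/q. Ideals between K and K + Ax are pulled back
    along a -> ax to colon ideals, and strict inclusions stay strict because every element has the
    form k + bx with k in K. *)
Lemma len_le_adjoin K x q l : is_ideal K -> (forall b, q b -> K (b * x)) ->
  len_le q setT l -> len_le K (adjoin K x) l.
Proof.
move=> idK qK hl n c; apply: hl.
suff: forall Z, ichain K n Z -> Z `<=` adjoin K x -> ichain q n (colon Z x).
  by move=> /(_ _ c (@subset_refl _ _)) /ichain_mono; apply.
move=> {c} Z; elim=> [z [idz Kz]|n' z w cz IH [zw nwz] [idw Kw]] sub.
  by apply: chain0; split; [exact: colon_ideal|move=> b /qK /Kz].
have [idz Kz] := chain_top cz.
apply: (chainS (IH (subset_trans zw sub))).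
  split=> [b /zw //|wz]; apply: nwz => t wt.
  have /adjoinP[k Kk [b e]] := sub t wt.
  rewrite e; apply: idealD => //; first exact: Kz.
  apply: wz; rewrite /colon /= -[b * x](addKr k) -e.
  by apply: idealD => //; apply: idealN => //; apply: Kw.
by split; [exact: colon_ideal|move=> b /qK /Kw].
Qed.

Lemma len_le_maximal (m : idealr A) : maximal_ideal m -> len_le [set` m] setT 1.
Proof.
move=> maxm n c; rewrite leqNgt; apply/negP => n2.
move: c; case: n n2 => [|[|n]] // _ c.
inversion c as [|n' z w cz zw _]; subst.
inversion cz as [|n' y w' cy yz _]; subst.
have [idz mz] := chain_top cz; have [idy my] := chain_top cy.
have nz1 : ~ z 1 by move=> /(ideal1 idz) e; apply: zw.2; rewrite e.
have [K eK] := mk_idealr idz nz1.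
apply: yz.2 => x; rewrite -eK => /= xK; apply: my => /=.
by apply: (maxm K) => // t tm; have : [set` K] t by rewrite eK; apply: mz.
Qed.

(** Each layer (K + (x^i)) / (K + (x^(i+1))) of the filtration by powers of x is a cyclic quotient
    of A/(K + (x)), so it adds at most [l]. *)
Lemma len_le_pow K x n l : is_ideal K ->
  len_le (adjoin K x) setT l -> len_le (adjoin K (x ^+ n)) setT (n * l).
Proof.
move=> idK hl; elim: n => [|n IH].
  move=> p; have -> : adjoin K (x ^+ 0) = setT.
    by rewrite expr0; apply: ideal1; [exact: adjoin_ideal|exact: mem_adjoin].
  case: p => // p c; inversion c as [|n z w cz zw _]; subst.
  by case: zw => _ []; case: (chain_top cz).
rewrite mulSn; apply: (@len_le_cat _ (adjoin K (x ^+ n))) => //.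
- exact: adjoin_ideal.
- apply: adjoin_min; [exact: adjoin_ideal|exact: sub_adjoin|].
  by rewrite exprS; apply: idealM; [exact: adjoin_ideal|exact: mem_adjoin].
have idK' : is_ideal (adjoin K (x ^+ n.+1)) by apply: adjoin_ideal.
have sub : adjoin K (x ^+ n) `<=` adjoin (adjoin K (x ^+ n.+1)) (x ^+ n).
  apply: adjoin_min; [exact: adjoin_ideal| |exact: mem_adjoin].
  by apply: subset_trans (@sub_adjoin _ _ _) (@sub_adjoin _ _ _).
move=> p /ichain_mono /(_ (adjoin_ideal _ idK') sub).
apply: len_le_adjoin hl _ => // b /adjoinP[k Kk [c ->]].
rewrite mulrDl -mulrA -exprS; apply: idealD => //.
  by apply: sub_adjoin; apply: idealMC.
by apply: idealM => //; apply: mem_adjoin.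
Qed.

Lemma gen_ideal (X : set A) s : is_ideal (gen X s).
Proof. exact: ideal_span_ideal. Qed.

Lemma gen_min (X : set A) s J : is_ideal J -> X `<=` J -> {in s, forall x, J x} ->
  gen X s `<=` J.
Proof. by move=> idJ XJ sJ; apply: ideal_span_le => // x [/XJ|/sJ]. Qed.

Lemma gen0E (s : seq A) : ideal_span [set` s] = gen set0 s.
Proof. by rewrite /gen set0U. Qed.

Lemma gen_cons (X : set A) x s : gen X (x :: s) = adjoin (gen X s) x.
Proof.
apply/seteqP; split.
  apply: gen_min; first exact/adjoin_ideal/gen_ideal.
    by move=> y Xy; apply/sub_adjoin/ideal_span_sub; left.
  move=> y; rewrite inE => /predU1P[->|ys]; first exact/mem_adjoin/gen_ideal.
  by apply/sub_adjoin/ideal_span_sub; right.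
apply: adjoin_min; first exact: gen_ideal.
  apply: ideal_span_mono => y [Xy|/= ys]; [by left|right].
  by rewrite /= inE ys orbT.
by apply: ideal_span_sub; right; rewrite /= mem_head.
Qed.

Lemma gen_setU1 (X : set A) x s : gen (x |` X) s = gen X (x :: s).
Proof.
congr ideal_span; apply/seteqP; split=> y; rewrite /= inE.
  by move=> [[->|Xy]|ys]; [right; rewrite eqxx|left|right; rewrite ys orbT].
by move=> [Xy|/predU1P[->|ys]]; [left; right|left; left|right].
Qed.

(** Each replacement of a generator by its power costs a factor [n]. Moving the head into [X] lets
    the tail be treated first, after which the head is raised to its power. *)
Lemma len_le_gen_pow (X : set A) s n l : len_le (gen X s) setT l ->
  len_le (gen X [seq x ^+ n | x <- s]) setT (n ^ size s * l).
Proof.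
elim: s X l => [|x s IH] X l /=; first by rewrite expn0 mul1n.
rewrite -gen_setU1 => /IH; rewrite gen_setU1 !gen_cons => /len_le_pow.
by rewrite expnS -mulnA; apply; apply: gen_ideal.
Qed.

End Lengths.

(** * Noetherian rings *)

Definition noeth (B : comNzRingType) : Prop :=
  forall J : set B, is_ideal J -> exists s : seq B, J = ideal_span [set` s].

Section Noetherian.
Variable B : comNzRingType.

Lemma noetherian_noeth : noetherian B -> noeth B.
Proof.
move=> nB J idJ; have [J1|nJ1] := pselect (J 1).
  exists [:: 1]; rewrite (ideal1 idJ J1); apply/esym/ideal1; first exact: ideal_span_ideal.
  by apply: ideal_span_sub; rewrite /= inE.
by have [K eK] := mk_idealr idJ nJ1; have [s e] := nB K; exists s; rewrite -eK.
Qed.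

Hypothesis nB : noeth B.

Lemma noeth_acc (f : nat -> set B) : (forall n, is_ideal (f n)) ->
  (forall n, f n `<=` f n.+1) -> exists N, forall n, (N <= n)%N -> f n = f N.
Proof.
move=> idf incf.
have mono i j : (i <= j)%N -> f i `<=` f j.
  move=> /subnKC <-; elim: (j - i)%N => [|k IH]; first by rewrite addn0.
  by rewrite addnS; apply: subset_trans (incf _).
have [|s es] := nB (J := \bigcup_n f n).
  split; first by exists 0 => //; apply: ideal0.
    move=> x y [i _ fx] [j _ fy]; exists (maxn i j) => //; apply: idealD => //.
      by apply: mono fx; apply: leq_maxl.
    by apply: mono fy; apply: leq_maxr.
  by move=> a x [i _ fx]; exists i => //; apply: idealM.
have [N sN] : exists N, {in s, forall x, f N x}.
  have : {in s, forall x, exists n, f n x}.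
    by move=> x xs; have : (\bigcup_n f n) x by [rewrite es; apply: ideal_span_sub];
       case=> n _; exists n.
  elim: s {es} => [|x s IH] h; first by exists 0.
  have [|N hN] := IH; first by move=> y ys; apply: h; rewrite inE ys orbT.
  have [n fx] := h x (mem_head _ _); exists (maxn n N) => y.
  rewrite inE => /predU1P[->|/hN fy]; first by apply: mono fx; apply: leq_maxl.
  by apply: mono fy; apply: leq_maxr.
exists N => n Nn; apply/seteqP; split; last exact: mono.
apply: subset_trans (ideal_span_le (idf N) (sN : [set` s] `<=` f N)).
by rewrite -es => x fx; exists n.
Qed.

Lemma noeth_ind (Phi : set B -> Prop) :
  (forall J, is_ideal J -> (forall K, is_ideal K -> J `<` K -> Phi K) -> Phi J) ->
  forall J, is_ideal J -> Phi J.
Proof.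
move=> step J0 idJ0; apply: contrapT => nPhi0.
have /choice[g hg] : forall J, exists K, is_ideal J -> ~ Phi J ->
    [/\ is_ideal K, J `<` K & ~ Phi K].
  move=> J; have [[idJ nPhi]|h] := pselect (is_ideal J /\ ~ Phi J); last first.
    by exists J => ? ?; case: h.
  apply: contrapT => /forallNP h; apply: nPhi; apply: step => // K idK JK.
  by apply: contrapT => nPhiK; apply: (h K).
have hf n : is_ideal (iter n g J0) /\ ~ Phi (iter n g J0).
  by elim: n => // n [? ?] /=; have [] := hg (iter n g J0).
have inc n : iter n g J0 `<` iter n.+1 g J0.
  by have [? ?] := hf n; have [] := hg (iter n g J0).
have [|n|N h] := noeth_acc (f := fun n => iter n g J0).
- by move=> n; case: (hf n).
- by case: (inc n).
- by case: (inc N) => _; rewrite (h _ (leqnSn N)); apply.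
Qed.

(** * Hilbert's basis theorem, by ideals of leading coefficients *)

Definition lead (J : set {poly B}) (n : nat) : set B :=
  [set b | exists p : {poly B}, [/\ J p, (size p <= n.+1)%N & p`_n = b]].

Lemma lead_ideal J n : is_ideal J -> is_ideal (lead J n).
Proof.
move=> idJ; split.
- by exists 0; rewrite size_poly0 coef0; split=> //; apply: ideal0.
- move=> _ _ [p [Jp sp <-]] [q [Jq sq <-]]; exists (p + q); rewrite coefD.
  by split=> //; [exact: idealD|rewrite (leq_trans (size_polyD _ _)) // geq_max sp].
- move=> a _ [p [Jp sp <-]]; exists (a *: p); rewrite coefZ; split=> //.
    by rewrite -mul_polyC; apply: idealM.
  by apply: leq_trans sp; apply: size_scale_leq.
Qed.

Lemma lead_inc J n : is_ideal J -> lead J n `<=` lead J n.+1.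
Proof.
move=> idJ _ [p [Jp sp <-]]; exists ('X * p); rewrite coefXM; split=> //.
  exact: idealM.
have [->|p0] := eqVneq p 0; first by rewrite mulr0 size_poly0.
by rewrite mulrC size_mulX.
Qed.

Lemma hilbert_basis : noeth {poly B}.
Proof.
move=> J idJ.
have [N hN] := noeth_acc (fun n => lead_ideal n idJ) (fun n => @lead_inc J n idJ).
have /choice[S hS] : forall n, exists s : seq {poly B},
    {in s, forall p, J p /\ (size p <= n.+1)%N} /\
    lead J n `<=` ideal_span [set` [seq p`_n | p : {poly B} <- s]].
  move=> n; have [t et] := nB (lead_ideal n idJ).
  have /choice[h hh] : forall b, exists p : {poly B}, lead J n b ->
      [/\ J p, (size p <= n.+1)%N & p`_n = b].
    move=> b; have [[p hp]|nb] := pselect (lead J n b); first by exists p.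
    by exists 0.
  have tl b : b \in t -> lead J n b by move=> bt; rewrite et; apply: ideal_span_sub.
  exists (map h t); split.
    by move=> _ /mapP[b /tl bt ->]; have [] := hh b bt.
  rewrite -map_comp map_id_in -?et // => b /tl bt /=.
  by have [] := hh b bt.
pose G := flatten [seq S n | n <- iota 0 N.+1].
have SG n p : (n <= N)%N -> p \in S n -> p \in G.
  by move=> nN pS; apply/flattenP; exists (S n) => //; apply: map_f; rewrite mem_iota.
have idG : is_ideal (ideal_span [set` G]) by apply: ideal_span_ideal.
exists G; apply/seteqP; split; last first.
  apply: ideal_span_le => // p /flattenP[_ /mapP[n _ ->] /(hS n).1].
  by case.
suff main n (p : {poly B}) : (size p <= n)%N -> J p -> ideal_span [set` G] p.
  by move=> p; apply: main.
elim: n p => [|n IH] p.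
  by rewrite leqn0 size_poly_eq0 => /eqP -> _; apply: ideal0.
(* Beyond degree N the ideals of leading coefficients no longer grow, so the leading coefficient of
   p already comes from generators of degree k; multiplying by X^(n - k) then cancels the top
   term. *)
move=> sp Jp; pose k := minn n N.
have kn : (k <= n)%N by apply: geq_minl.
have : lead J k p`_n.
  have : lead J n p`_n by exists p.
  by rewrite /k; case: (leqP n N) => [/minn_idPl //|/ltnW Nn]; rewrite (hN n).
move=> /(hS k).2.
have sub : ideal_span [set` [seq p`_k | p : {poly B} <- S k]] `<=`
    [set b | exists q : {poly B}, [/\ J q, ideal_span [set` G] q,
       (size q <= k.+1)%N & q`_k = b]].
  apply: ideal_span_le.
    split=> [|_ _ [u [? ? su <-]] [v [? ? sv <-]]|a _ [u [? ? su <-]]].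
    - by exists 0; rewrite size_polyC eqxx coef0; split=> //; apply: ideal0.
    - exists (u + v); rewrite coefD; split=> //; try exact: idealD.
      by rewrite (leq_trans (size_polyD _ _)) // geq_max su.
    - exists (a *: u); rewrite coefZ; split=> //; last exact: leq_trans (size_scale_leq _ _) _.
        by rewrite -mul_polyC; apply: idealM.
      by rewrite -mul_polyC; apply: idealM.
  move=> _ /mapP[u uS ->]; exists u; have [Ju su] := (hS k).1 u uS; split=> //.
  by apply/ideal_span_sub/(SG k) => //; apply: geq_minr.
move=> /sub[q [Jq Gq sq eq]].
apply: (idealBE (y := 'X^(n - k) * q)) => //; first exact: idealM.
apply: IH; last by apply: idealB => //; apply: idealM.
apply/leq_sizeP => j nj; rewrite coefB coefXnM.
have -> : (j < n - k)%N = false by lia.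
move: nj; rewrite leq_eqVlt => /predU1P[<-|nj].
  by rewrite subKn // eq subrr.
rewrite [p`_j]nth_default ?[q`_ _]nth_default ?subrr //.
  by apply: leq_trans sq _; lia.
by apply: leq_trans sp _.
Qed.

End Noetherian.

(** * Graded ideals of the Rees algebra *)

(* A homogeneous ideal of the Rees algebra of [I] is represented by the set of pairs
   [(n, a)] such that it contains the form [a t^n]. *)
Definition slice (A : Type) (P : set (nat * A)) (n : nat) : set A :=
  [set a | P (n, a)].

Definition graded (A : comNzRingType) (I : idealr A) (P : set (nat * A)) : Prop :=
  [/\ forall n, is_ideal (slice P n),
      forall x, P x -> ideal_pow [set` I] x.1 x.2 &
      forall i j a b, P (i, a) -> ideal_pow [set` I] j b -> P ((i + j)%N, a * b)].

Section Graded.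
Variables (A : comNzRingType) (I : idealr A).
Hypothesis nA : noeth A.
Local Notation Ip := (ideal_pow [set` I]).

(** An iterated polynomial ring, with one variable for each element x of [s], evaluated at xt.
    Having a Noetherian ring over the Rees algebra is enough, since its ideals can be studied
    through their preimages. *)
Lemma rees_cover (s : seq A) : {in s, forall x, x \in I} ->
  exists (B : comNzRingType) (f : {rmorphism B -> {poly A}}),
    [/\ noeth B, forall b, f b \in rees_pred I, forall a, exists b, f b = a%:P &
        {in s, forall x, exists b, f b = x *: 'X}].
Proof.
elim: s => [_|x s IH sI].
  exists A, (polyC : {rmorphism A -> {poly A}}); split=> // [b|a]; last by exists a.
  by apply/rees_predP => -[//|i]; rewrite coefC; apply: ideal_pow0.
have [|B [f [nB fI fC fs]]] := IH; first by move=> y ys; apply: sI; rewrite inE ys orbT.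
pose g : {rmorphism {poly B} -> {poly A}} := horner_eval (x *: 'X) \o map_poly f.
have gC b : g b%:P = f b by rewrite /g /= /horner_eval map_polyC hornerC.
exists {poly B}, g; split.
- exact: hilbert_basis.
- move=> p; rewrite /g /= /horner_eval horner_coef; apply: rpred_sum => i _.
  apply: rpredM; first by rewrite coef_map; apply: fI.
  apply: rpredX; apply/rees_predP => j; rewrite coefZ coefX.
  case: eqP => [->|_]; last by rewrite mulr0; apply: ideal_pow0.
  by rewrite mulr1 ideal_pow1; [apply: sI; apply: mem_head|exact: idealr_ideal].
- by move=> a; have [b <-] := fC a; exists b%:P.
- move=> y; rewrite inE => /predU1P[->|/fs[b <-]]; last by exists b%:P.
  by exists 'X; rewrite /g /= /horner_eval map_polyX hornerX.
Qed.

Lemma rees_noeth : exists (B : comNzRingType) (f : {rmorphism B -> {poly A}}),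
  [/\ noeth B, forall b i, Ip i (f b)`_i &
      forall n a, Ip n a -> exists b, f b = a *: 'X^n].
Proof.
have [s es] := nA (idealr_ideal I).
have sI : {in s, forall x, x \in I}.
  by move=> x xs; have : [set` I] x by rewrite es; apply: ideal_span_sub.
have [B [f [nB fI fC fs]]] := rees_cover sI.
exists B, f; split=> // [b i|]; first exact/rees_predP.
elim=> [|n IH] a.
  by move=> _; have [b fb] := fC a; exists b; rewrite expr0 fb alg_polyC.
have fD (X : set A) k : (forall x, X x -> exists b, f b = x *: 'X^k) ->
    forall x, ideal_span X x -> exists b, f b = x *: 'X^k.
  move=> Xf; apply: ideal_span_min => //=.
  - by exists 0; rewrite rmorph0 scale0r.
  - by move=> x y [b hb] [c hc]; exists (b + c); rewrite rmorphD /= hb hc scalerDl.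
  - move=> c x [b hb]; have [c' hc] := fC c.
    by exists (c' * b); rewrite rmorphM /= hb hc mul_polyC scalerA.
apply: (fD _) => _ [x Ix [y /IH[b fb] <-]].
have [c fc] : exists c, f c = x *: 'X^1 by apply: (fD [set` s]) => //; rewrite -es.
by exists (c * b); rewrite rmorphM /= fb fc -scalerAl -scalerAr scalerA -exprD.
Qed.

Lemma graded0 P n : graded I P -> P (n, 0).
Proof. by case=> /(_ n) /ideal0. Qed.

Lemma gradedM P i j a b : graded I P -> P (i, a) -> Ip j b -> P ((i + j)%N, a * b).
Proof. by case=> _ _; apply. Qed.

Lemma pullback_ideal (B : comNzRingType) (f : {rmorphism B -> {poly A}}) P :
  (forall b i, Ip i (f b)`_i) -> graded I P ->
  is_ideal [set b | forall i, P (i, (f b)`_i)].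
Proof.
move=> fI gP; have [idP PI PM] := gP; split=> /=.
- by move=> i; rewrite rmorph0 coef0; apply: graded0.
- by move=> x y Px Py i; rewrite rmorphD coefD; apply: (idealD (idP i)).
- move=> a x Px i; rewrite rmorphM mulrC coefM.
  apply: (ideal_sum (J := slice P i)) => // j _.
  have ji : (j <= i)%N by rewrite -ltnS.
  by rewrite /slice /= -[X in P (X, _)](subnKC ji); apply: PM.
Qed.

(** Noetherian induction on preimages in the covering ring; strict inclusions survive because every
    form a t^n has a preimage. *)
Lemma graded_noeth_ind (Phi : set (nat * A) -> Prop) :
  (forall P, graded I P -> (forall Q, graded I Q -> P `<` Q -> Phi Q) -> Phi P) ->
  forall P, graded I P -> Phi P.
Proof.
move=> step; have [B [f [nB fI fX]]] := rees_noeth.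
pose pb (P : set (nat * A)) := [set b : B | forall i, P (i, (f b)`_i)].
suff main J : is_ideal J -> forall P, graded I P -> pb P = J -> Phi P.
  by move=> P gP; apply: (main (pb P)) => //; apply: pullback_ideal.
move: J; apply: noeth_ind => // J idJ IH P gP eJ; apply: step => // Q gQ [PQ nQP].
apply: (IH (pb Q)) => //; first exact: pullback_ideal.
rewrite -eJ; split=> [b Pb i|QP]; first exact/PQ/Pb.
apply: nQP => -[n a] Qa; have [_ QI _] := gQ.
have [b fb] := fX n a (QI _ Qa).
have : pb P b.
  apply: QP => i; rewrite fb coefZ coefXn; case: eqP => [->|_]; first by rewrite mulr1.
  by rewrite mulr0; apply: graded0.
by move=> /(_ n); rewrite fb coefZ coefXn eqxx mulr1.
Qed.

(** The preimage of P has finitely many generators, and [c] bounds the sizes of their images;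
    comparing coefficients of t^n expresses w by pieces of degree at most [c]. *)
Lemma graded_fg P : graded I P -> exists c, forall n w, P (n, w) ->
  ideal_span [set x | exists j u v,
    [/\ (j <= c)%N, (j <= n)%N, P (j, u), Ip (n - j) v & x = u * v]] w.
Proof.
move=> gP; have [idP PI PM] := gP; have [B [f [nB fI fX]]] := rees_noeth.
have [t et] := nB _ (pullback_ideal fI gP).
exists (\max_(b <- t) size (f b)) => n w Pw.
set X := [set x | _]; have idX : is_ideal (ideal_span X) by apply: ideal_span_ideal.
have [b fb] := fX n w (PI _ Pw).
suff : ideal_span X (f b)`_n by rewrite fb coefZ coefXn eqxx mulr1.
have : ideal_span [set` t] b.
  rewrite -et => i; rewrite fb coefZ coefXn; case: eqP => [->|_]; first by rewrite mulr1.
  by rewrite mulr0; apply: graded0.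
have : forall y, y \in t -> forall a, ideal_span X (f (a * y))`_n.
  move=> y yt a; rewrite rmorphM mulrC coefM; apply: ideal_sum => // j _.
  have [yj|jy] := leqP (size (f y)) j.
    by rewrite nth_default // mul0r; apply: ideal0.
  apply: ideal_span_sub; exists j, (f y)`_j, (f a)`_(n - j); split=> //.
  - by apply: leq_trans (ltnW jy) _; apply: leq_bigmax_seq.
  - by rewrite -ltnS.
  - by have : [set b | forall i, P (i, (f b)`_i)] y by rewrite et; apply: ideal_span_sub.
move=> h [k [c [y [ty ->]]]]; rewrite raddf_sum coef_sum; apply: ideal_sum => // i _.
exact/h/ty.
Qed.

(* The forms [w t^n] with [w] in [P + (a)] make up a homogeneous ideal of the Rees algebra,
   which is generated in degrees at most some [c]. *)
Lemma artin_rees P a : is_prime P -> ~ P a ->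
  exists c, forall n b, add_ideal P (Ip (n + c)) (a * b) -> add_ideal P (Ip n) b.
Proof.
move=> [idP _ primeP] nPa; have ida := adjoin_ideal a idP.
pose q : set (nat * A) := [set x | Ip x.1 x.2 /\ adjoin P a x.2].
have gq : graded I q.
  split=> [n|x [] //|i j x y [/= Ix Px] Iy].
    by apply: (setI_ideal (ideal_pow_ideal _ n) ida).
  by split=> /=; [exact: ideal_pow_mul|exact: idealMC].
have [c hc] := graded_fg gq; exists c => n b [p Pp [w Iw e]].
have qw : q ((n + c)%N, w).
  split=> //=; apply/adjoinP; exists (- p); first exact: idealN.
  by exists b; rewrite [b * a]mulrC -e addKr.
(* The generators of [q] have degree j at most c, so their cofactors lie in I^(n + c - j), which is
   inside I^n; modulo P each generator is a multiple of a. *)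
have [u Iu Pu] : exists2 u, Ip n u & P (w - a * u).
  move: (hc _ _ qw); apply: (ideal_span_le (J := [set w | exists2 u, Ip n u & P (w - a * u)])).
    split.
    - by exists 0; [exact: ideal_pow0|rewrite mulr0 subr0; exact: ideal0].
    - move=> x y [u Iu Pu] [v Iv Pv]; exists (u + v); first exact: ideal_powD.
      by rewrite mulrDr opprD addrACA; apply: idealD.
    - move=> d x [u Iu Pu]; exists (d * u); first exact: ideal_powMl.
      by rewrite mulrCA -mulrBr; apply: idealM.
  move=> _ [j [u [v [jc jn [_ /= /adjoinP[p' Pp' [d ->]]] Iv ->]]]].
  exists (d * v).
    by apply: ideal_powMl; apply: ideal_pow_anti Iv; lia.
  by rewrite mulrDl [d * a]mulrC -mulrA addrK; apply: idealMC.
have : P (a * (b - u)).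
  by rewrite mulrBr -e -addrA; apply: idealD.
move=> /primeP[//|Pb]; exists (b - u) => //; exists u => //; exact: subrK.
Qed.

End Graded.

(** * Growth of lengths *)

(* [Hi n N] is read as [N <= h_i(n)], so the hypothesis is [h_0(n) + h_1(n + a) <= h_0(n + a)]
   and growth of order [j] of [h_1] yields growth of order [j + 1] of [h_0]. *)
Lemma growth_step (H0 H1 : nat -> nat -> Prop) (a c j : nat) :
  (forall n, H0 n 0%N) ->
  (forall n N0 N1, H0 n N0 -> H1 (n + a)%N N1 -> H0 (n + a)%N (N0 + N1)%N) ->
  (forall k n, (c * k < n)%N -> H1 n (k ^ j)%N) ->
  forall k n, ((c + a) * k < n)%N -> H0 n (k ^ j.+1)%N.
Proof.
move=> H00 step h1 k n; rewrite mulnDl expnS.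
(* Each shift by [a] gains one more copy of [k ^ j]; k shifts give the extra factor k. *)
suff main i p : (c * k + a * i < p)%N -> H0 p (i * k ^ j)%N by apply: main.
elim: i p => [|i IH] p; first by rewrite mul0n.
rewrite mulnS => lt; have -> : p = (p - a + a)%N by lia.
by rewrite mulSn [(k ^ j + _)%N]addnC; apply: step; [apply: IH|apply: h1]; lia.
Qed.

(** For k at least 1 the right side is at most (2c)^s l k^s. If s < j, the choice of k just above
    (2c)^s l makes k^(s+1) exceed it. *)
Lemma growth_exponent (j s c l : nat) :
  (forall k, k ^ j <= (c * k.+1) ^ s * l)%N -> (j <= s)%N.
Proof.
move=> h; rewrite leqNgt; apply/negP => sj.
pose k := ((c * 2) ^ s * l).+1.
have k0 : (0 < k ^ s)%N by rewrite expn_gt0.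
have : (k ^ s.+1 <= (c * 2) ^ s * l * k ^ s)%N.
  apply: leq_trans (leq_pexp2l (ltn0Sn _) sj) _; apply: leq_trans (h k) _.
  rewrite mulnAC -expnMn leq_mul2r; apply/orP; right.
  have [->|s0] := posnP s; first by rewrite !expn0.
  by rewrite leq_exp2r // -mulnA leq_mul2l /k; lia.
by rewrite expnS leq_pmul2r // ltnn.
Qed.

(** * Local rings: growth along chains of primes, and Nakayama's lemma *)

Section PrimeChains.
Variables (A : comNzRingType) (m : idealr A).
Hypotheses (nA : noeth A) (locA : local_with m).

(** Noetherian induction in place of Zorn's lemma: a proper ideal is either maximal, hence [m], or
    strictly inside another proper ideal. *)
Lemma local_proper (J : set A) : is_ideal J -> ~ J 1 -> J `<=` [set` m].
Proof.
move: J; apply: (noeth_ind nA) => J idJ IH nJ1; have [K eK] := mk_idealr idJ nJ1.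
have [maxK|] := pselect (maximal_ideal K).
  by move=> x; rewrite -eK /= (locA.2 K maxK).
move=> /existsNP[L /not_implyP[KL /existsNP[x /not_implyP[Lx nKx]]]].
apply: (@subset_trans _ [set` L]); first by rewrite -eK.
apply: IH; [exact: idealr_ideal| |by rewrite /= idealr1].
by rewrite -eK; split=> // /(_ x Lx).
Qed.

Lemma local_unit x : x \notin m -> exists y, x * y = 1.
Proof.
move=> xm; apply: contrapT => nx.
have := @local_proper (scale_ideal x setT) (scale_ideal_ideal _ (setT_ideal _)).
move=> /(_ _ x) /=; rewrite (negPf xm) => h; suff : false by []; apply: h.
  by move=> [y _ e]; apply: nx; exists y.
by exists 1 => //; rewrite mulr1.
Qed.

(** The chain descends, so [P] is its smallest member. For f in P1 outside P0, multiplication by f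
    sends chains above P0 + I^n to chains between P0 + I^(n+a) and P1 + I^(n+a), where a is the
    Artin-Rees shift; a chain from P1 + I^(n+a) to A is then placed on top. *)
Lemma prime_chain_growth (I : idealr A) j P :
  chain (fun X Y => Y `<` X) (@is_prime A) j P ->
  exists c, forall k n, (c * k < n)%N ->
    ichain (add_ideal P (ideal_pow [set` I] n)) (k ^ j) setT.
Proof.
have idPI Q n : is_prime Q -> is_ideal (add_ideal Q (ideal_pow [set` I] n)).
  by case=> idQ _ _; apply: add_ideal_ideal => //; apply: ideal_pow_ideal.
elim=> [{}P primeP|{}j P1 P0 c1 [c hc] [P01 nP10] primeP].
  exists 0 => k n n0; rewrite expn0; apply: ichain1 => //; first exact: idPI.
  split=> // /(_ 1 Logic.I); suff /[apply] : add_ideal P (ideal_pow [set` I] n) `<=` [set` m].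
    by rewrite /= idealr1.
  have Im : [set` I] `<=` [set` m].
    by apply: local_proper; [exact: idealr_ideal|rewrite /= idealr1].
  have [idP nP1 _] := primeP.
  apply: add_ideal_min; [exact: idealr_ideal|exact: local_proper|].
  apply: subset_trans Im; rewrite -[X in _ `<=` X](ideal_pow1 (idealr_ideal I)).
  exact: ideal_pow_anti.
have [f [P1f nP0f]] : exists f, P1 f /\ ~ P0 f.
  by apply: contrapT => h; apply: nP10 => x P1x; apply: contrapT => nP0x; apply: h; exists x.
have [a ha] := artin_rees I nA primeP nP0f.
have idP1 := chain_top c1; have [idP0 _ _] := primeP.
exists (c + a)%N; apply: (growth_step
  (H0 := fun n N => ichain (add_ideal P0 (ideal_pow [set` I] n)) N setT)
  (H1 := fun n N => ichain (add_ideal P1 (ideal_pow [set` I] n)) N setT)) => //.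
  by move=> n; apply: chain0; split.
move=> n N0 N1 h0 h1; apply: ichain_cat h1.
have idK := idPI P0 (n + a)%N primeP.
apply: ichain_mono (ichain_scale (a := f) idK _ h0) _ _ => //; last 1 first.
- apply: add_ideal_min; first exact: idPI.
    by move=> _ [x /P01 P1x [y Iy <-]]; exists x => //; exists y.
  move=> _ [x _ <-]; apply: sub_add_ideall; first exact: ideal_pow_ideal.
  by case: idP1 => idP1 _ _; apply: idealMC.
- by move=> b _; apply: ha.
- exact: idPI.
Qed.

(** The n-th powers of the generators lie in I^n, so the length of A/(Q + I^n) is at most n^s l,
    with s their number. With n = ck + 1 it is at least k^j, and n is at most (c + 1)(k + 1). *)
Lemma prime_chain_le_size s (I : idealr A) l j P : [set` I] = gen set0 s ->
  len_le [set` I] setT l -> chain (@proper A) (@is_prime A) j P -> (j <= size s)%N.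
Proof.
move=> eI hl cP; have [Q cQ] := chain_rev cP.
have [c hc] := prime_chain_growth I cQ; have [idQ _ _] := chain_top cQ.
apply: (@growth_exponent _ _ c.+1 l) => k.
pose n := (c * k).+1.
have sub : gen set0 [seq x ^+ n | x <- s] `<=` add_ideal Q (ideal_pow [set` I] n).
  apply: gen_min => //.
    by apply: add_ideal_ideal => //; apply: ideal_pow_ideal.
  move=> _ /mapP[x xs ->]; apply: sub_add_idealr => //; apply: ideal_pow_exp; rewrite eI.
  by apply: ideal_span_sub; right.
have := hc k n (ltnSn _); rewrite eI in hl.
move=> /(len_le_mono sub (len_le_gen_pow (n := n) hl)) /leq_trans; apply.
rewrite leq_mul2r; apply/orP; right.
have [->|s0] := posnP (size s); first by rewrite !expn0.
by rewrite leq_exp2r // /n; lia.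
Qed.

(** Finitely many generators of [m] have a common exponent n with all n-th powers in J, and A/m has
    length one. *)
Lemma len_le_primary J : is_ideal J -> (forall x, x \in m -> exists n, J (x ^+ n)) ->
  exists l, len_le J setT l.
Proof.
move=> idJ hJ; have [g eg] := nA (idealr_ideal m).
have gm : {in g, forall x, x \in m}.
  by move=> x xg; have : [set` m] x by rewrite eg; apply: ideal_span_sub.
have [n hn] : exists n, {in g, forall x, J (x ^+ n)}.
  elim: g gm {eg} => [|x g IH] gm; first by exists 0%N.
  have [|n hn] := IH; first by move=> y yg; apply: gm; rewrite inE yg orbT.
  have [p hp] := hJ x (gm x (mem_head _ _)); exists (n + p)%N => y.
  rewrite inE exprD => /predU1P[->|/hn]; first exact: idealM.
  exact: idealMC.
exists (n ^ size g * 1)%N; apply: len_le_mono (_ : gen set0 [seq x ^+ n | x <- g] `<=` _) _.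
  by apply: gen_min => // _ /mapP[x xg ->]; apply: hn.
by apply: len_le_gen_pow; rewrite -gen0E -eg; apply: len_le_maximal; case: locA.
Qed.

(** Generators are discarded one at a time: the head satisfies x = y + ax with y in the ideal of the
    others and a in [m], and 1 - a is a unit. *)
Lemma nakayama s (K : set A) : is_ideal K ->
  gen K s `<=` add_ideal K (ideal_mul [set` m] (gen K s)) -> gen K s `<=` K.
Proof.
move=> idK; elim: s => [|x s IH] sub.
  by apply: gen_min.
have idm := idealr_ideal m; have idg := gen_ideal K s.
have xs : gen K s x.
  have : add_ideal (gen K s) (scale_ideal x [set` m]) x.
    have : gen K (x :: s) x by apply: ideal_span_sub; right; apply: mem_head.
    move=> /sub; apply: add_ideal_min.
    - by apply: add_ideal_ideal => //; apply: scale_ideal_ideal.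
    - move=> y Ky; apply: sub_add_ideall; first exact: scale_ideal_ideal.
      by apply: ideal_span_sub; left.
    - apply: ideal_mul_le => [|a y am].
        by apply: add_ideal_ideal => //; apply: scale_ideal_ideal.
      rewrite gen_cons => /adjoinP[k gk [b ->]]; exists (a * k); first exact: idealM.
      exists (x * (a * b)); first by exists (a * b) => //; apply: idealMC.
      by rewrite mulrDr [x * _]mulrC mulrA.
  move=> [y gy [_ [a am <-] e]].
  have [u eu] : exists u, (1 - a) * u = 1.
    apply: local_unit; apply/negP => am'; suff : 1 \in m by rewrite idealr1.
    by have := idealD idm am' am; rewrite subrK.
  rewrite -[x]mulr1 -eu mulrA; apply: idealMC => //.
  suff -> : x * (1 - a) = y by [].
  by rewrite mulrBr mulr1 -{1}e addrK.
have e : gen K (x :: s) = gen K s.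
  apply/seteqP; split; rewrite gen_cons; [exact: adjoin_min|exact: sub_adjoin].
by rewrite e; apply: IH; rewrite -e.
Qed.

End PrimeChains.

(** * Prime decomposition and prime avoidance *)

(* The axioms below cover both the ideals of a ring and the homogeneous ideals of a graded
   ring, seen as sets of homogeneous elements; [U] is the set of legal elements. *)
Section IdealSystem.
Variables (T : Type) (op : T -> T -> T) (e : T) (U : set T).
Variables (Idl : set (set T)) (adj : set T -> T -> set T).

(** Properness is not included, so the set of all legal elements counts as prime; points exclude it
    through [Pts1]. *)
Definition op_prime (P : set T) : Prop :=
  Idl P /\ forall x y, U x -> U y -> P (op x y) -> P x \/ P y.

Fixpoint op_prod (L : seq (set T)) : set T :=
  if L is P :: L' then [set op x y | x in P & y in op_prod L'] else [set e].

Hypotheses (opA : associative op) (opC : commutative op) (op1 : left_id e op).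
Hypotheses (Ue : U e) (Uop : forall x y, U x -> U y -> U (op x y)).
Hypotheses (IdlU : forall J, Idl J -> J `<=` U)
  (IdlM : forall J x y, Idl J -> J x -> U y -> J (op x y))
  (adjI : forall J u, Idl J -> U u -> Idl (adj J u))
  (sub_adj : forall J u, Idl J -> U u -> J `<=` adj J u)
  (mem_adj : forall J u, Idl J -> U u -> adj J u u)
  (adj_min : forall J u K, Idl K -> U u -> J `<=` K -> K u -> adj J u `<=` K)
  (adjM : forall J u v x y, Idl J -> U u -> U v -> J (op u v) ->
     adj J u x -> adj J v y -> J (op x y))
  (Idl_ind : forall Phi : set T -> Prop,
     (forall J, Idl J -> (forall K, Idl K -> J `<` K -> Phi K) -> Phi J) ->
     forall J, Idl J -> Phi J).

Lemma op_prod_cat L1 L2 :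
  op_prod (L1 ++ L2) `<=` [set op x y | x in op_prod L1 & y in op_prod L2].
Proof.
elim: L1 => [|P L1 IH] /= z; first by move=> Lz; exists e => //; exists z => //; rewrite op1.
move=> [x Px [y /IH[u L1u [v L2v <-]] <-]].
exists (op x u); first by exists x => //; exists u.
by exists v => //; rewrite opA.
Qed.

(** If uv lies in J with u and v outside, the primes found over J + (u) and over J + (v) together
    have their product in (J + (u))(J + (v)), inside J. Such a list stands in for the minimal
    primes: any proper prime over J contains one of its members. *)
Lemma prime_decomposition J : Idl J ->
  exists L : seq (set T), (forall Q, Q \in L -> op_prime Q /\ J `<=` Q) /\ op_prod L `<=` J.
Proof.
move: J; apply: Idl_ind => J idJ IH.
have [pJ|npJ] := pselect (op_prime J).
  exists [:: J]; split=> [Q|z /= [x Jx [y -> <-]]]; last exact: IdlM.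
  by rewrite inE => /eqP ->; split.
have [u [v [Uu Uv [Juv nJu nJv]]]] : exists u v, [/\ U u, U v & [/\ J (op u v), ~ J u & ~ J v]].
  apply: contrapT => h; apply: npJ; split=> // u v Uu Uv Juv.
  apply: contrapT => /not_orP[nJu nJv]; apply: h; by exists u, v.
have lt w : U w -> ~ J w -> J `<` adj J w.
  by move=> Uw nJw; split; [exact: sub_adj|move=> h; apply/nJw/h/mem_adj].
have [L1 [hL1 pL1]] := IH _ (adjI idJ Uu) (lt u Uu nJu).
have [L2 [hL2 pL2]] := IH _ (adjI idJ Uv) (lt v Uv nJv).
exists (L1 ++ L2); split=> [Q|z /op_prod_cat[x /pL1 Jx [y /pL2 Jy <-]]]; last exact: adjM Jx Jy.
rewrite mem_cat => /orP[/hL1|/hL2] [pQ sub]; split=> //.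
  by apply: subset_trans sub; apply: sub_adj.
by apply: subset_trans sub; apply: sub_adj.
Qed.

Lemma op_prodU (L : seq (set T)) : (forall Q, Q \in L -> Idl Q) -> op_prod L `<=` U.
Proof.
elim: L => [|Q L IH] hL /= z; first by move->.
move=> [x Qx [y Ly <-]]; apply: Uop; first by apply: (IdlU (hL Q (mem_head _ _))).
by apply: IH Ly => R RL; apply: hL; rewrite inE RL orbT.
Qed.

Lemma op_prime_prod P (L : seq (set T)) : op_prime P -> ~ P e -> (forall Q, Q \in L -> Idl Q) ->
  op_prod L `<=` P -> exists2 Q, Q \in L & Q `<=` P.
Proof.
move=> [idP pP] nPe; elim: L => [|Q L IH] hL /= sub; first by case: nPe; apply: sub.
have [QP|/existsNP[x /not_implyP[Qx nPx]]] := pselect (Q `<=` P).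
  by exists Q => //; apply: mem_head.
have hL' R : R \in L -> Idl R by move=> RL; apply: hL; rewrite inE RL orbT.
have [|R RL RP] := IH hL'; last by exists R => //; rewrite inE RL orbT.
move=> y Ly; have : P (op x y) by apply: sub; exists x => //; exists y.
move=> /pP[||//|//]; last exact: op_prodU Ly.
exact: (IdlU (hL Q (mem_head _ _))).
Qed.

Variables (Pts : set (set T)) (E : set T) (J0 : set T).
Hypotheses (EU : E `<=` U) (idJ0 : Idl J0) (J0P : forall P, Pts P -> J0 `<=` P)
  (PtsP : forall P, Pts P -> op_prime P) (Pts1 : forall P, Pts P -> ~ P e)
  (Pts_down : forall P Q, Pts P -> op_prime Q -> J0 `<=` Q -> Q `<=` P -> Pts Q)
  (EM : forall x y, E x -> U y -> E (op x y))
  (E_point : forall P, Pts P -> exists2 u, E u & ~ P u)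
  (E0 : exists u, E u)
  (E_comb : forall u v, E u -> E v -> exists2 w, E w &
     forall P, Pts P -> (P u /\ ~ P v) \/ (~ P u /\ P v) -> ~ P w).

Lemma prime_separate P (L : seq (set T)) : Pts P -> (forall Q, Q \in L -> Pts Q /\ ~ (Q `<=` P)) ->
  exists2 v, E v & ~ P v /\ forall Q, Q \in L -> Q v.
Proof.
move=> PP; elim: L => [|Q L IH] hL; first by have [u Eu nPu] := E_point PP; exists u.
have [|v Ev [nPv hv]] := IH; first by move=> R RL; apply: hL; rewrite inE RL orbT.
have [PQ /existsNP[x /not_implyP[Qx nPx]]] := hL Q (mem_head _ _).
have [idQ _] := PtsP PQ; have Ux := IdlU idQ Qx.
exists (op v x); first exact: EM.
have [_ pP] := PtsP PP; split=> [/pP[]//|R]; first exact: EU.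
rewrite inE => /predU1P[->|RL]; first by rewrite opC; apply: IdlM => //; apply: EU.
have RP : Pts R by case: (hL R); rewrite // inE RL orbT.
by apply: IdlM => //; [case: (PtsP RP)|exact: hv].
Qed.

Lemma prime_avoidance (L : seq (set T)) : (forall Q, Q \in L -> Pts Q) ->
  exists2 u, E u & forall Q, Q \in L -> ~ Q u.
Proof.
have [n] := ubnP (size L); elim: n L => // n IH [|P L] /= szL hL.
  by have [u Eu] := E0; exists u.
have hL' Q : Q \in L -> Pts Q by move=> QL; apply: hL; rewrite inE QL orbT.
have PP := hL P (mem_head _ _).
have [[Q QL QP]|nQ] := pselect (exists2 Q, Q \in L & Q `<=` P).
  have [||u Eu hu] := IH (P :: rem Q L).
  - by rewrite /= size_rem //; case: (L) QL szL.
  - by move=> R; rewrite inE => /predU1P[->//|/mem_rem /hL'].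
  exists u => // R; rewrite inE => /predU1P[->|]; first exact/hu/mem_head.
  rewrite (perm_mem (perm_to_rem QL)) inE => /predU1P[->|RL].
    by move=> /QP; apply/hu/mem_head.
  by apply: hu; rewrite inE RL orbT.
have [//|u Eu hu] := IH L _ hL'.
have [Pu|nPu] := pselect (P u); last first.
  by exists u => // Q; rewrite inE => /predU1P[->|/hu].
have [|v Ev [nPv hv]] := @prime_separate P L PP.
  by move=> Q QL; split; [exact: hL'|move=> QP; apply: nQ; exists Q].
have [w Ew hw] := E_comb Eu Ev; exists w => // Q.
rewrite inE => /predU1P[->|QL]; first by apply: hw => //; left.
by apply: hw; [exact: hL'|right; split; [exact: hu|exact: hv]].
Qed.

Lemma adj_foldP (s : seq T) : List.Forall U s ->
  Idl (foldl adj J0 s) /\ forall P, Idl P ->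
    (foldl adj J0 s `<=` P <-> J0 `<=` P /\ List.Forall P s).
Proof.
elim/last_ind: s => [_|s u IH]; first by split=> // P _; split=> [|[]].
rewrite -cats1 => /List.Forall_app[/IH[idJ hJ] Us].
inversion Us as [|? ? Uu _]; subst.
rewrite foldl_cat /=; split=> [|P idP]; first exact: adjI.
split=> [sub|[J0Q /List.Forall_app[sP uP]]].
  have /(hJ P idP)[? ?] : foldl adj J0 s `<=` P.
    by apply: subset_trans sub; apply: sub_adj.
  split=> //; apply/List.Forall_app; split=> //; constructor; last by constructor.
  by apply/sub/mem_adj.
inversion uP; subst; apply: adj_min => //.
by apply/hJ.
Qed.

(* If the points carry no chain of length [n], then choosing [n] elements one at a time
   outside the primes minimal over the previous ones leaves no point through all of them. *)
Lemma no_common_point n : (forall P, ~ chain (@proper T) Pts n P) ->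
  exists s : seq T, [/\ size s = n, List.Forall E s &
    forall P, Pts P -> ~ List.Forall P s].
Proof.
move=> nochain.
suff main i : exists s : seq T, [/\ size s = i, List.Forall E s &
    forall P, Pts P -> List.Forall P s -> chain (@proper T) Pts i P].
  have [s [szs Es hs]] := main n; exists s; split=> // P PP Ps.
  exact: nochain (hs P PP Ps).
elim: i => [|i [s [szs Es hs]]]; first by exists [::]; split=> // P PP _; apply: chain0.
have Us : List.Forall U s by apply: List.Forall_impl Es => x; apply: EU.
have [idJ hJ] := adj_foldP Us.
have [L [hL pL]] := prime_decomposition idJ.
(* Only the listed primes that are points are avoided; a listed prime inside a point is itself a
   point, by [Pts_down]. *)
have [|u Eu hu] := @prime_avoidance [seq Q <- L | `[< Pts Q >]].
  by move=> Q; rewrite mem_filter => /andP[/asboolP].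
exists (s ++ [:: u]); split; first by rewrite size_cat szs addn1.
  by apply/List.Forall_app; split=> //; constructor.
move=> P PP /List.Forall_app[sP uP]; inversion uP as [|? ? Pu _]; subst.
have pP := PtsP PP; have idP := pP.1.
have sub : op_prod L `<=` P by apply: subset_trans pL _; apply/hJ => //; split=> //; exact: J0P.
have [|Q QL QP] := op_prime_prod pP (Pts1 PP) _ sub.
  by move=> Q /hL[[]].
have [pQ JQ] := hL Q QL; have /(hJ Q pQ.1)[J0Q sQ] := JQ.
have PQ : Pts Q by apply: Pts_down QP.
apply: (chainS (hs Q PQ sQ)) => //; split=> // /(_ u Pu).
by apply: hu; rewrite mem_filter QL andbT; apply/asboolP.
Qed.

End IdealSystem.

(** * Systems of parameters *)

(** Ideal systems live over a bare type, where [List.Forall] stands for list membership. *)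
Lemma ForallP (T : eqType) (Q : T -> Prop) (s : seq T) :
  List.Forall Q s <-> {in s, forall x, Q x}.
Proof.
elim: s => [|x s [IH1 IH2]]; first by split=> // _; constructor.
split=> [h y|h].
  inversion h as [|? ? Qx Qs]; subst; rewrite inE => /predU1P[->//|ys]; exact: IH1.
constructor; first exact/h/mem_head.
by apply: IH2 => y ys; apply: h; rewrite inE ys orbT.
Qed.

Section ParameterIdeals.
Variable A : comNzRingType.
Hypothesis nA : noeth A.

Lemma adjoinM (J : set A) u v x y : is_ideal J -> J (u * v) ->
  adjoin J u x -> adjoin J v y -> J (x * y).
Proof.
move=> idJ Juv /adjoinP[j Jj [a ->]] /adjoinP[j' Jj' [b ->]].
rewrite mulrDl; apply: idealD => //; first exact: idealMC.
rewrite mulrDr; apply: idealD => //; first exact: idealM.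
by rewrite mulrACA; apply: idealM.
Qed.

Lemma ideal_decomposition (J : set A) : is_ideal J ->
  exists L : seq (set A),
    (forall Q, Q \in L -> op_prime *%R setT (@is_ideal A) Q /\ J `<=` Q) /\
    op_prod *%R 1 L `<=` J.
Proof.
apply: (prime_decomposition (adj := @adjoin A)) => //.
- exact: mulrA.
- exact: mul1r.
- by move=> K x y idK Kx _; apply: idealMC.
- by move=> K u idK _; apply: adjoin_ideal.
- by move=> K u idK _; apply: sub_adjoin.
- by move=> K u idK _; apply: mem_adjoin.
- by move=> K u v x y idK _ _; apply: adjoinM.
- exact: noeth_ind.
Qed.

Lemma prime_exp (P : set A) x n : is_prime P -> P (x ^+ n) -> P x.
Proof.
case=> idP nP1 pP; elim: n => [|n IH]; first by rewrite expr0.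
by rewrite exprS => /pP[].
Qed.

Variable m : idealr A.
Hypothesis locA : local_with m.

(** The points are the primes other than [m]: a chain of length d among them would extend by [m] to
    one of length d + 1. Hence d elements of I exist that no such prime contains, and they generate
    an ideal of finite colength. *)
Lemma parameters (I : idealr A) d : (forall x, x \in m -> exists n, x ^+ n \in I) ->
  (forall P, ~ chain (@proper A) (@is_prime A) d.+1 P) ->
  exists s : seq A, [/\ size s = d, {in s, forall x, x \in I} &
    exists l, len_le (gen set0 s) setT l].
Proof.
move=> mI nochain.
pose Pts : set (set A) := [set P | is_prime P /\ P <> [set` m]].
have prime_m : is_prime [set` m].
  split; [exact: idealr_ideal|by rewrite /= idealr1|move=> x y /= xym].
  apply: contrapT => /not_orP[/negP/(local_unit nA locA)[a ea] nym].
  apply: nym; have -> : y = a * (x * y) by rewrite mulrA [a * x]mulrC ea mul1r.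
  exact: idealMr.
have PtsE P : Pts P -> exists2 u, [set` I] u & ~ P u.
  move=> [pP nPm]; apply: contrapT => h; apply: nPm.
  have [idP nP1 _] := pP.
  apply/seteqP; split; first exact: (local_proper nA locA).
  move=> x /mI[n xI]; apply: (prime_exp (n := n)) => //.
  by apply: contrapT => nPx; apply: h; exists (x ^+ n).
have [s [szs sI hs]] : exists s : seq A, [/\ size s = d, List.Forall [set` I] s &
    forall P, Pts P -> ~ List.Forall P s].
  apply: (@no_common_point A *%R 1 setT (@is_ideal A) (@adjoin A) _ _ _ _ _ _ _ _ _ _ _ _ _
    Pts [set` I] [set 0]) => //.
  - exact: mulrA.
  - exact: mulrC.
  - exact: mul1r.
  - by move=> K x y idK Kx _; apply: idealMC.
  - by move=> K u idK _; apply: adjoin_ideal.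
  - by move=> K u idK _; apply: sub_adjoin.
  - by move=> K u idK _; apply: mem_adjoin.
  - by move=> K u L idL _; apply: adjoin_min.
  - by move=> K u v x y idK _ _; apply: adjoinM.
  - exact: noeth_ind.
  - by split=> [//|x y -> ->|a x ->] /=; rewrite ?addr0 ?mulr0.
  - by move=> P [[idP _ _] _] x ->; apply: ideal0.
  - by move=> P [[idP nP1 pP] _]; split=> // x y _ _; apply: pP.
  - by move=> P [[idP nP1 pP] _].
  - move=> P Q [[idP nP1 pP] nPm] [idQ pQ] _ QP; split.
      by split=> // [/QP//|x y]; apply: pQ.
    move=> e; apply: nPm; apply/seteqP; split; first exact: (local_proper nA locA).
    by rewrite -e.
  - by move=> x y Ix _; apply: (idealMC _ (idealr_ideal I)).
  - by exists 0; apply: (ideal0 (idealr_ideal I)).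
  - move=> u v Iu Iv; exists (u + v); first exact: (idealD (idealr_ideal I)).
    move=> P [[idP _ _] _] [[Pu nPv]|[nPu Pv]] Puv.
      by apply: nPv; rewrite -[v](addKr u); apply: idealD => //; apply: idealN.
    by apply: nPu; rewrite -[u](addrK v); apply: idealB.
  - move=> P cP; apply: (nochain [set` m]).
    apply: chainS prime_m; first by apply: chain_sub cP => Q [].
    have [[idP nP1 _] nPm] := chain_top cP.
    have Pm := local_proper nA locA idP nP1; split=> // mP.
    by apply: nPm; apply/seteqP.
have {}sI : {in s, forall x, x \in I} by apply/ForallP.
exists s; split=> //.
have idJ := gen_ideal set0 s; apply: (len_le_primary nA locA idJ) => x xm.
have [L [hL pL]] := ideal_decomposition idJ.
exists (size L); apply: pL.
(* Every listed prime over the ideal is the unit ideal or [m], hence contains x; so x^(size L) is a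
   product of members. *)
have : {in L, forall Q, Q x}.
  move=> Q /hL[[idQ pQ] JQ].
  have [Q1|nQ1] := pselect (Q 1); first by rewrite (ideal1 idQ Q1).
  have [->//|nQm] := pselect (Q = [set` m]).
  exfalso; apply: (hs Q); first by split=> //; split=> // a b; apply: pQ.
  by apply/ForallP => y ys; apply/JQ/ideal_span_sub; right.
elim: L {hL} => [|Q L IH] h /=; first by [].
exists x; first by apply: h; apply: mem_head.
exists (x ^+ size L); last by rewrite exprS.
by apply: IH => R RL; apply: h; rewrite inE RL orbT.
Qed.

End ParameterIdeals.

(** * Homogeneous primes of the fiber cone *)

Definition gop (A : comNzRingType) (x y : nat * A) : nat * A :=
  ((x.1 + y.1)%N, x.2 * y.2).

Definition gcarrier (A : comNzRingType) (I : idealr A) : set (nat * A) :=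
  [set x | ideal_pow [set` I] x.1 x.2].

(* The degree [n] part of the principal ideal of the Rees algebra generated by [u]. *)
Definition princ (A : comNzRingType) (I : idealr A) (u : nat * A) (n : nat) : set A :=
  if (u.1 <= n)%N then scale_ideal u.2 (ideal_pow [set` I] (n - u.1)) else [set 0].

Definition gadj (A : comNzRingType) (I : idealr A) (J : set (nat * A)) (u : nat * A) :
    set (nat * A) :=
  [set x | add_ideal (slice J x.1) (princ I u x.1) x.2].

Definition gzero (A : comNzRingType) (m I : idealr A) : set (nat * A) :=
  [set x | ideal_mul [set` m] (ideal_pow [set` I] x.1) x.2].

Definition gprime (A : comNzRingType) (I : idealr A) : set (set (nat * A)) :=
  op_prime (@gop A) (gcarrier I) (graded I).

(* The points of [Proj] of the fiber cone, as sets of forms of the Rees algebra: [gzero]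
   is the preimage of [0], and relevance can be tested in degree [1]. *)
Definition gpoint (A : comNzRingType) (m I : idealr A) : set (set (nat * A)) :=
  [set P | [/\ gprime I P, gzero m I `<=` P & exists2 x, x \in I & ~ P (1%N, x)]].

Section GradedPrimes.
Variables (A : comNzRingType) (m I : idealr A).
Local Notation Ip := (ideal_pow [set` I]).
Implicit Types (P Q J : set (nat * A)) (u v : nat * A).

Lemma ideal_pow1_mem x : x \in I -> Ip 1 x.
Proof. by rewrite (ideal_pow1 (idealr_ideal I)). Qed.

Lemma gopA : associative (@gop A).
Proof. by move=> x y z; rewrite /gop addnA mulrA. Qed.

Lemma gopC : commutative (@gop A).
Proof. by move=> x y; rewrite /gop addnC mulrC. Qed.

Lemma gop1 : left_id (0%N, 1) (@gop A).
Proof. by move=> [n a]; rewrite /gop add0n mul1r. Qed.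

Lemma gcarrierM u v : gcarrier I u -> gcarrier I v -> gcarrier I (gop u v).
Proof. exact: ideal_pow_mul. Qed.

Lemma gradedU J : graded I J -> J `<=` gcarrier I.
Proof. by case. Qed.

Lemma graded_op J u v : graded I J -> J u -> gcarrier I v -> J (gop u v).
Proof. by move=> [_ _ JM] Ju; apply: JM; case: u Ju. Qed.

Lemma princ_ideal u n : is_ideal (princ I u n).
Proof.
rewrite /princ; case: ifP => _; first exact/scale_ideal_ideal/ideal_pow_ideal.
by split=> [//|x y -> ->|a x ->] /=; rewrite ?addr0 ?mulr0.
Qed.

Lemma princP u n w :
  princ I u n w <-> w = 0 \/ exists k y, [/\ n = (u.1 + k)%N, Ip k y & w = u.2 * y].
Proof.
rewrite /princ; case: leqP => un; split.
- by move=> [y Iy <-]; right; exists (n - u.1)%N, y; split=> //; rewrite subnKC.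
- move=> [->|[k [y [-> Iy ->]]]].
    by apply: ideal0; apply: scale_ideal_ideal; apply: ideal_pow_ideal.
  by rewrite addKn; exists y.
- by move=> ->; left.
- by move=> [//|[k [y [e]]]]; move: un; rewrite e; lia.
Qed.

Lemma gadj_graded J u : graded I J -> gcarrier I u -> graded I (gadj I J u).
Proof.
move=> gJ Iu; have [idJ JI JM] := gJ; split.
- by move=> n; apply: add_ideal_ideal => //; apply: princ_ideal.
- move=> [n a] [j /JI Ij [w /princP hw <-]]; apply: ideal_powD => //=.
  case: hw => [->|[k [y [/= -> Iy ->]]]]; first exact: ideal_pow0.
  exact: ideal_pow_mul.
- move=> n p a b [j Jj [w /princP hw /= <-]] Ib; rewrite mulrDl.
  exists (j * b); first exact: JM.
  exists (w * b) => //; apply/princP => /=.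
  case: hw => [->|[k [y [/= -> Iy ->]]]]; first by left; rewrite mul0r.
  by right; exists (k + p)%N, (y * b); rewrite addnA mulrA; split=> //; apply: ideal_pow_mul.
Qed.

Lemma sub_gadj J u : J `<=` gadj I J u.
Proof. by move=> [n a] Ja; apply: sub_add_ideall => //; apply: princ_ideal. Qed.

Lemma mem_gadj J u : graded I J -> gadj I J u u.
Proof.
move=> [idJ _ _]; apply: sub_add_idealr => //; apply/princP; right.
by exists 0%N, 1; rewrite addn0 mulr1.
Qed.

Lemma gadj_min J u Q : graded I Q -> J `<=` Q -> Q u -> gadj I J u `<=` Q.
Proof.
move=> gQ JQ Qu [n a] [j /JQ Qj [w /princP hw /= <-]]; have [idQ _ QM] := gQ.
apply: (idealD (idQ n)) => //; case: hw => [->|[k [y [/= -> Iy ->]]]].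
  by apply: ideal0.
by rewrite /slice /=; apply: QM => //; case: u Qu.
Qed.

Lemma gadjM J u v x y : graded I J -> gcarrier I u -> gcarrier I v -> J (gop u v) ->
  gadj I J u x -> gadj I J v y -> J (gop x y).
Proof.
move=> gJ Iu Iv Juv gx gy; have := gradedU (gadj_graded gJ Iv) gy.
case: x gx => n a [j /= Jj [w /princP hw <-]] {a}; case: y gy => p b gy Ib.
have [idJ JI JM] := gJ; rewrite /gop /= mulrDl; apply: (idealD (idJ _)).
  exact: JM.
rewrite /slice /=; case: hw => [->|[k [z [/= -> Iz ->]]]].
  by rewrite mul0r; apply: graded0 gJ.
case: gy => j' Jj' [w' /princP hw' /= <-]; rewrite mulrDr; apply: (idealD (idJ _)).
  by rewrite /slice /= addnC mulrC; apply: JM => //; apply: ideal_pow_mul.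
rewrite /slice /=; case: hw' => [->|[k' [z' [/= -> Iz' ->]]]].
  by rewrite mulr0; apply: graded0 gJ.
by rewrite addnACA mulrACA; apply: JM Juv _; apply: ideal_pow_mul.
Qed.

Lemma gzero_graded : graded I (gzero m I).
Proof.
split=> [n|[n a] /=|i j a b /= hab Ib]; first exact: ideal_mul_ideal.
  by apply: ideal_mul_le => [|x y _]; [exact: ideal_pow_ideal|exact: ideal_powMl].
suff : ideal_mul [set` m] (Ip i) `<=` [set a | ideal_mul [set` m] (Ip (i + j)) (a * b)].
  by apply.
apply: ideal_mul_le => [|x y xm Iy]; last first.
  by rewrite /= -mulrA; apply: ideal_mul_mem => //; apply: ideal_pow_mul.
exact/colon_ideal/ideal_mul_ideal.
Qed.

Hypotheses (nA : noeth A) (locA : local_with m).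

Lemma graded_decomposition J : graded I J ->
  exists L : seq (set (nat * A)), (forall Q, Q \in L -> gprime I Q /\ J `<=` Q) /\
    op_prod (@gop A) (0%N, 1) L `<=` J.
Proof.
apply: (prime_decomposition (adj := @gadj A I)).
- exact: gopA.
- exact: gop1.
- by [].
- by move=> K x y; apply: graded_op.
- by move=> K u; apply: gadj_graded.
- by move=> K u _ _; apply: sub_gadj.
- by move=> K u gK _; apply: mem_gadj.
- by move=> K u v x y; apply: gadjM.
- exact: graded_noeth_ind.
Qed.

Lemma gpoint_graded P : gpoint m I P -> graded I P.
Proof. by case=> [[]]. Qed.

Lemma gpoint1 P : gpoint m I P -> ~ P (0%N, 1).
Proof.
move=> [[gP _] _ [x Ix nPx]] P1; apply: nPx.
rewrite -[1%N]add0n -[x]mul1r; apply: (gradedM gP P1).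
exact: ideal_pow1_mem.
Qed.

Lemma gpoint_prime P i j a b : gpoint m I P -> Ip i a -> Ip j b ->
  P ((i + j)%N, a * b) -> P (i, a) \/ P (j, b).
Proof. by move=> [[_ pP] _ _] Ia Ib; apply: (pP (i, a) (j, b)). Qed.

Lemma gpoint_exp P i a k : gpoint m I P -> Ip i a -> P ((k * i)%N, a ^+ k) -> P (i, a).
Proof.
move=> PP Ia; elim: k => [/(gpoint1 PP)//|k IH]; rewrite mulSn exprS.
by move=> /(gpoint_prime PP Ia (ideal_pow_exp_mul _ Ia))[].
Qed.

(** In degree zero the fiber cone is the field k, and a proper ideal meets a field only in zero. *)
Lemma gpoint0 P a : gpoint m I P -> P (0%N, a) <-> a \in m.
Proof.
move=> PP; have [_ zP _] := PP; have gP := gpoint_graded PP; split=> [Pa|am].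
  apply: contrapT => /negP /(local_unit nA locA)[b ab]; apply: (gpoint1 PP).
  by rewrite -ab -[0%N]addn0; apply: (gradedM gP).
by apply: zP; rewrite /gzero /= -[a]mulr1; apply: ideal_mul_mem.
Qed.

Lemma gpoint_avoid n : (forall P, ~ chain (@proper _) (gpoint m I) n P) ->
  exists s : seq (nat * A), [/\ size s = n,
    List.Forall [set u | (0 < u.1)%N /\ gcarrier I u] s &
    forall P, gpoint m I P -> ~ List.Forall P s].
Proof.
apply: (@no_common_point _ (@gop A) (0%N, 1) (gcarrier I) (graded I) (@gadj A I)
  _ _ _ _ _ _ _ _ _ _ _ _ _ _ _ (gzero m I)).
- exact: gopA.
- exact: gopC.
- exact: gop1.
- by [].
- exact: gcarrierM.
- exact: gradedU.
- by move=> K x y; apply: graded_op.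
- by move=> K u; apply: gadj_graded.
- by move=> K u _ _; apply: sub_gadj.
- by move=> K u gK _; apply: mem_gadj.
- by move=> K u Q gQ _; apply: gadj_min.
- by move=> K u v x y; apply: gadjM.
- exact: graded_noeth_ind.
- by move=> u [].
- exact: gzero_graded.
- by move=> P [].
- by move=> P [].
- exact: gpoint1.
- move=> P Q [_ _ [x Ix nPx]] pQ zQ QP; split=> //; exists x => //; exact: contra_not (QP _) nPx.
- by move=> u v [u0 Iu] Iv; split; [rewrite /= ltn_addr|exact: gcarrierM].
- move=> P [_ _ [x Ix nPx]]; exists (1%N, x) => //; split=> //.
  exact: ideal_pow1_mem.
- by exists (1%N, 0); split=> //; apply: ideal_pow0.
(* Forms of degrees i and j become addable as a^j and b^i, both of degree ij; primality lets a and b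
   be recovered from their powers. *)
- move=> [i a] [j b] [/= i0 Ia] [/= j0 Ib].
  have Iaj := ideal_pow_exp_mul j Ia; have Ibi := ideal_pow_exp_mul i Ib.
  have Ibi' : Ip (j * i) (b ^+ i) by rewrite mulnC.
  exists ((j * i)%N, a ^+ j + b ^+ i).
    by split; [rewrite /= muln_gt0 j0|apply: ideal_powD].
  have powP P k l (c : A) : gpoint m I P -> (0 < k)%N -> Ip l c -> P (l, c) ->
      P ((k * l)%N, c ^+ k).
    move=> PP; case: k => // k _ Ic Pc; rewrite mulSn exprS.
    exact: (gradedM (gpoint_graded PP)) Pc (ideal_pow_exp_mul k Ic).
  move=> P PP h Psum; have [idP _ _] := gpoint_graded PP.
  case: h => [[Pa nPb]|[nPa Pb]].
    apply/nPb/(gpoint_exp PP Ib (k := i)); rewrite mulnC.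
    rewrite -[b ^+ i](addKr (a ^+ j)); apply: (idealD (idP _)) => //.
    by apply: (idealN (idP _)); apply: powP.
  apply/nPa/(gpoint_exp PP Ia (k := j)); rewrite -[a ^+ j](addrK (b ^+ i)).
  apply: (idealB (idP _)) => //; rewrite mulnC; exact: powP.
Qed.

End GradedPrimes.

(** * The dimension of the fiber cone *)

Section Dimension.
Variables (A : comNzRingType) (m I : idealr A).
Local Notation Ip := (ideal_pow [set` I]).
Implicit Types (P Q : set (nat * A)).
Hypotheses (nA : noeth A) (locA : local_with m).
Hypothesis mI : forall x, x \in m <-> exists n, x ^+ n \in I.

(** As I is inside [m], I^(n+1) lies in mI^n. Chains in I^n/P_n are thus chains in I^n/I^(n+1), and
    those of consecutive degrees can be glued. *)
Lemma ideal_pow_sub_slice P n : gpoint m I P -> Ip n.+1 `<=` slice P n.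
Proof.
move=> [_ zP _]; apply: subset_trans (_ : ideal_mul [set` m] (Ip n) `<=` _); last first.
  by move=> x hx; apply: zP.
apply: ideal_mul_le => [|x y Ix Iy]; first exact: ideal_mul_ideal.
by apply: ideal_mul_mem => //; apply/mI; exists 1%N.
Qed.

(** A form f of degree a outside P0 acts injectively modulo P0 and shifts degrees by exactly a, so
    the descent from P1 to P0 takes place without Artin-Rees. At the largest prime, I^n differs from
    P_n because x^n stays outside P. *)
Lemma gpoint_chain_growth j P :
  chain (fun X Y => Y `<` X) (gpoint m I) j P ->
  exists c, forall k n, (c * k < n)%N -> ichain (slice P n) (k ^ j) (Ip n).
Proof.
elim=> [{}P PP|{}j P1 P0 c1 [c hc] [P01 nP10] PP0].
  have gP := gpoint_graded PP; have [idP PI _] := gP; have [_ _ [x Ix nPx]] := PP.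
  exists 0%N => k n n0; rewrite expn0; apply: ichain1 => //; first exact: ideal_pow_ideal.
  split=> [a /PI //|sub]; apply/nPx/(gpoint_exp PP (k := n)); first exact: ideal_pow1_mem.
  by rewrite muln1; apply/sub/ideal_pow_exp.
have [[a f] [P1f nP0f]] : exists f, P1 f /\ ~ P0 f.
  by apply: contrapT => h; apply: nP10 => x P1x; apply: contrapT => nP0x; apply: h; exists x.
have PP1 := chain_top c1; have [id0 _ _] := gpoint_graded PP0.
have [id1 I1 M1] := gpoint_graded PP1; have If := I1 _ P1f.
exists (c + a)%N; apply: (growth_step
  (H0 := fun n N => ichain (slice P0 n) N (Ip n))
  (H1 := fun n N => ichain (slice P1 n) N (Ip n))) => //.
  move=> n; apply: chain0; split; first exact: ideal_pow_ideal.
  by case: (gpoint_graded PP0) => _ I0 _ b /I0.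
move=> n N0 N1 h0 h1; apply: ichain_cat h1.
apply: ichain_mono (ichain_scale (a := f) (id0 (n + a)%N) _ h0) _ _; last 1 first.
- apply: add_ideal_min; first exact: id1.
    by move=> b /P01.
  by move=> _ [y Iy <-]; rewrite /slice /= addnC; apply: M1.
- move=> b Ib; rewrite /slice /= addnC => /(gpoint_prime PP0 If Ib)[] //.
- exact: id1.
Qed.

Lemma gpoint_chain_lt d e P : (forall Q : set A, ~ chain (@proper A) (@is_prime A) d.+1 Q) ->
  chain (@proper _) (gpoint m I) e P -> (e < d)%N.
Proof.
move=> nochain cP; have [P0 cP0] := chain_rev cP.
have [c hc] := gpoint_chain_growth cP0; have PP0 := chain_top cP0.
have [|s [szs sI [l hl]]] := parameters nA locA (I := I) _ nochain.
  by move=> x /mI.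
rewrite -szs; apply: (@growth_exponent _ _ c.+1 l) => k.
(* Each degree from ck + 1 to ck + k contributes [k ^ e], so the glued chain from I^n to I^(ck+1)
   has length [k ^ e.+1]; moreover n is at most (c + 1)(k + 1). *)
pose n := ((c * k).+1 + k)%N.
have long i : ichain (Ip ((c * k).+1 + i)) (i * k ^ e) (Ip (c * k).+1).
  elim: i => [|i IH].
    by rewrite addn0; apply: chain0; split=> //; apply: ideal_pow_ideal.
  rewrite mulSn; apply: ichain_cat IH.
  have := hc k ((c * k).+1 + i)%N; rewrite leq_addr => /(_ isT).
  apply: chain_sub => Z [idZ sub]; split=> //; apply: subset_trans sub.
  by rewrite addnS; apply: ideal_pow_sub_slice.
have sub : gen set0 [seq x ^+ n | x <- s] `<=` Ip n.
  apply: gen_min => //; first exact: ideal_pow_ideal.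
  by move=> _ /mapP[x /sI xI ->]; apply: ideal_pow_exp.
have : ichain (gen set0 [seq x ^+ n | x <- s]) (k ^ e.+1) setT.
  rewrite expnS; apply: (ichain_mono (L := Ip (c * k).+1)) => //.
  by apply: chain_sub (long k) => Z [idZ IZ]; split=> //; apply: subset_trans IZ.
move=> /(len_le_gen_pow (n := n) hl) /leq_trans; apply.
rewrite leq_mul2r; apply/orP; right.
have [->|s0] := posnP (size s); first by rewrite !expn0.
by rewrite leq_exp2r // /n; lia.
Qed.

(** This is the projective Nullstellensatz: the homogeneous primes listed over J are not points, so
    they contain all of I in degree one, and a product of r elements of I, with r the length of the
    list, lies in their product, hence in J. *)
Lemma ideal_pow_sub_decomposition J : graded I J -> gzero m I `<=` J ->
  (forall P, gpoint m I P -> ~ J `<=` P) -> exists r, Ip r `<=` slice J r.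
Proof.
move=> gJ zJ noP; have [L [hL pL]] := graded_decomposition nA gJ.
have LI Q : Q \in L -> forall x, x \in I -> Q (1%N, x).
  move=> /hL[gQ JQ] x xI; apply: contrapT => nQx; apply: (noP Q) => //; split=> //.
    exact: subset_trans JQ.
  by exists x.
exists (size L); have [idJ _ _] := gJ.
apply: subset_trans (_ : ideal_span (slice (op_prod (@gop A) (0%N, 1) L) (size L)) `<=` _).
  elim: L LI {hL pL} => [_ x _|Q L IH LI] /=.
    by rewrite -[x]mulr1; apply: ideal_spanMl; apply: ideal_span_sub.
  apply: ideal_mul_le => [|x y Ix]; first exact: ideal_span_ideal.
  have LI' R : R \in L -> forall x, x \in I -> R (1%N, x).
    by move=> RL; apply: LI; rewrite inE RL orbT.
  move=> /(IH LI'); rewrite [x * y]mulrC; set X := (X in _ -> X _).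
  apply: (ideal_span_le (J := colon X x)).
    exact/colon_ideal/ideal_span_ideal.
  move=> z Lz; rewrite /colon /= mulrC; apply: ideal_span_sub.
  exists (1%N, x); first exact: (LI Q (mem_head _ _)).
  by exists (size L, z) => //; rewrite /gop /= add1n.
by apply: ideal_span_le => // x /pL.
Qed.

(** The n forms may have different positive degrees; forgetting these leaves n elements of I
    generating K. Having no common zero gives I^r inside K + mI^r, so Nakayama puts I^r inside K and
    K has finite colength. *)
Lemma prime_chain_le n j (P : set A) : (forall Q, ~ chain (@proper _) (gpoint m I) n Q) ->
  chain (@proper A) (@is_prime A) j P -> (j <= n)%N.
Proof.
move=> /(gpoint_avoid nA)[s [szs sE hs]] cP.
have idI := idealr_ideal I.
have sU : List.Forall (gcarrier I) s by apply: List.Forall_impl sE => u [].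
have [gJ hJ] : graded I (foldl (@gadj A I) (gzero m I) s) /\ forall Q, graded I Q ->
    (foldl (@gadj A I) (gzero m I) s `<=` Q <-> gzero m I `<=` Q /\ List.Forall Q s).
  apply: (adj_foldP (U := gcarrier I)) => //.
  - by move=> K u; apply: gadj_graded.
  - by move=> K u _ _; apply: sub_gadj.
  - by move=> K u gK _; apply: mem_gadj.
  - by move=> K u Q gQ _; apply: gadj_min.
  - exact: gzero_graded.
set J := foldl _ _ _ in gJ hJ.
have /(hJ J gJ)[zJ _] := @subset_refl _ J.
have [|r hr] := ideal_pow_sub_decomposition gJ zJ.
  by move=> Q QQ /(hJ Q (gpoint_graded QQ))[_]; apply: hs.
pose t := [seq u.2 | u <- s]; pose K := gen set0 t.
have idK : is_ideal K := gen_ideal set0 t.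
have KI : K `<=` [set` I].
  apply: gen_min => // _ /mapP[[i a] us ->] /=; move: us.
  have /ForallP h := sE; move=> /h[/= i0 /(ideal_pow_anti i0)].
  by rewrite ideal_pow1.
have {hr} Ir : Ip r `<=` add_ideal K (ideal_mul [set` m] (Ip r)).
  (* Elements of K + mI^i in each degree i form a homogeneous ideal that contains [gzero] and the
     chosen forms, hence J. *)
  pose Q := [set u : nat * A | Ip u.1 u.2 /\ add_ideal K (ideal_mul [set` m] (Ip u.1)) u.2].
  suff JQ : J `<=` Q by move=> x /hr /JQ[].
  have [idz zI zM] := @gzero_graded A m I.
  have gQ : graded I Q.
    split=> [i|u []//|i k a b [/= Ia [x Kx [y zy exy]]] Ib].
      apply: (setI_ideal (ideal_pow_ideal _ i)); apply: add_ideal_ideal => //.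
      exact: ideal_mul_ideal.
    split; first exact: (ideal_pow_mul Ia Ib).
    rewrite /= -exy mulrDl; exists (x * b); first exact: idealMC.
    by exists (y * b) => //; apply: (zM i k y b).
  apply/hJ => //; split=> [[i a] za|].
    split; first exact: zI.
    exact: sub_add_idealr.
  apply/ForallP => u us; split; first by move/ForallP: sU; apply.
  apply: sub_add_ideall; first exact: ideal_mul_ideal.
  by apply: ideal_span_sub; right; apply: map_f.
have IK : Ip r `<=` K.
  have [g eg] := nA (ideal_pow_ideal [set` I] r).
  have sub : Ip r `<=` gen K g.
    by rewrite eg; apply: ideal_span_mono => x; right.
  apply: (subset_trans sub); apply: (nakayama nA locA idK).
  apply: gen_min.
  - by apply: add_ideal_ideal => //; apply: ideal_mul_ideal.
  - by apply: sub_add_ideall; apply: ideal_mul_ideal.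
  - move=> x xg; have /Ir[y Ky [z zz <-]] : Ip r x by rewrite eg; apply: ideal_span_sub.
    exists y => //; exists z => //; move: zz; apply: ideal_mul_le; first exact: ideal_mul_ideal.
    by move=> a b am /sub gb; apply: ideal_mul_mem.
have nK1 : ~ K 1 by move=> /KI; rewrite /= idealr1.
have [Kr eK] := mk_idealr idK nK1.
have [l hl] : exists l, len_le K setT l.
  apply: (len_le_primary nA locA idK) => x /mI[k xI]; exists (k * r)%N; apply: IK.
  by rewrite exprM; apply: ideal_pow_exp.
rewrite -szs -(size_map snd); rewrite -eK in hl.
exact: (prime_chain_le_size nA locA eK hl cP).
Qed.

End Dimension.

(** * Points of the projective spectrum *)

Local Open Scope quotient_scope.

Section ProjPoints.
Variables (A : comNzRingType) (m I : idealr A).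
Local Notation Ip := (ideal_pow [set` I]).
Local Notation R := (fiber_ring m I).
Local Notation X := (Proj (fiber_cone m I)).
Implicit Types (P : X) (Q : set (nat * A)).

(* The element [a t^n] of the Rees algebra; it is the junk value [0] unless [a] is in [I^n]. *)
Definition mon (x : nat * A) : rees I := insubd (0 : rees I) (x.2 *: 'X^(x.1)).

Definition cls (r : rees I) : R := \pi_R r.

Lemma val_mon n a : Ip n a -> val (mon (n, a)) = a *: 'X^n.
Proof.
move=> Ia; rewrite val_insubd; case: ifP => // /negP[]; apply/rees_predP => i.
rewrite coefZ coefXn; case: eqP => [->|_]; first by rewrite mulr1.
by rewrite mulr0; apply: ideal_pow0.
Qed.

Lemma monD n a b : Ip n a -> Ip n b -> mon (n, a + b) = mon (n, a) + mon (n, b).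
Proof.
move=> Ia Ib; apply: val_inj; rewrite (raddfD \val) /= !val_mon //; last exact: ideal_powD.
by rewrite scalerDl.
Qed.

Lemma monM i j a b : Ip i a -> Ip j b ->
  mon ((i + j)%N, a * b) = mon (i, a) * mon (j, b).
Proof.
move=> Ia Ib; apply: val_inj; rewrite (rmorphM \val) /= !val_mon //; last exact: ideal_pow_mul.
by rewrite -scalerAl -scalerAr scalerA exprD.
Qed.

Lemma mon0 n : mon (n, 0) = 0.
Proof. by apply: val_inj; rewrite val_mon ?scale0r //; apply: ideal_pow0. Qed.

Lemma rees_coef (r : rees I) i : Ip i (val r)`_i.
Proof. exact/rees_predP/(valP r). Qed.

Lemma rees_sum (r : rees I) : r = \sum_(i < size (val r)) mon (i : nat, (val r)`_i).
Proof.
apply: val_inj; rewrite (raddf_sum \val) /= -[LHS]coefK poly_def.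
by apply: eq_bigr => i _; rewrite val_mon //; apply: rees_coef.
Qed.

Lemma clsD r s : cls (r + s) = cls r + cls s.
Proof. by rewrite /cls raddfD. Qed.

Lemma clsB r s : cls (r - s) = cls r - cls s.
Proof. by rewrite /cls raddfB. Qed.

Lemma clsM r s : cls (r * s) = cls r * cls s.
Proof. by rewrite /cls rmorphM. Qed.

Lemma cls0 : cls 0 = 0.
Proof. by rewrite /cls raddf0. Qed.

Lemma cls1 : cls 1 = 1.
Proof. by rewrite /cls rmorph1. Qed.

Lemma cls_sum (J : Type) (r : seq J) (C : pred J) (f : J -> rees I) :
  cls (\sum_(i <- r | C i) f i) = \sum_(i <- r | C i) cls (f i).
Proof. by rewrite /cls raddf_sum. Qed.

Lemma cls_surj (x : R) : exists r, x = cls r.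
Proof. by exists (repr x); rewrite /cls reprK. Qed.

Lemma cls_eq0 r : cls r = 0 <-> forall i, gzero m I (i, (val r)`_i).
Proof.
have E : \pi_R r = 0 <-> r \in @fiber_pred A m I.
  rewrite -[r in X in _ <-> X]subr0 Quotient.idealrBE -(raddf0 \pi_R).
  by split=> [e|/eqP]; [apply/eqP|].
by rewrite /cls E; split=> [/fiber_predP|h]; [|apply/fiber_predP].
Qed.

Definition forms (S : set R) : set (nat * A) :=
  [set x | gcarrier I x /\ S (cls (mon x))].

(** The condition is imposed on one lift only; when [Q] is graded and contains [gzero], it then
    holds for every lift, by [of_formsP]. *)
Definition of_forms (Q : set (nat * A)) : set R :=
  [set cls r | r in [set r : rees I | forall i, Q (i, (val r)`_i)]].

Lemma gzero_cls x : gzero m I x -> cls (mon x) = 0.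
Proof.
case: x => n a za; have [_ zI _] := @gzero_graded A m I.
have Ia : Ip n a := zI _ za.
apply/cls_eq0 => i; rewrite val_mon // coefZ coefXn.
case: eqP => [->|_]; first by rewrite mulr1.
by rewrite mulr0; apply: ideal_span0.
Qed.

Lemma of_formsP Q r : graded I Q -> gzero m I `<=` Q ->
  of_forms Q (cls r) <-> forall i, Q (i, (val r)`_i).
Proof.
move=> [idQ _ _] zQ; split=> [[s Qs e] i|Qr]; last by exists r.
apply: (idealBE (idQ i) (y := (val s)`_i)) => //.
apply: zQ; have /cls_eq0 /(_ i) : cls (r - s) = 0 by rewrite clsB e subrr.
by rewrite (raddfB \val) coefB.
Qed.

Lemma of_formsK Q : graded I Q -> gzero m I `<=` Q -> forms (of_forms Q) = Q.
Proof.
move=> gQ zQ; have [idQ QI _] := gQ; apply/seteqP; split=> [[n a] [Ia /of_formsP]|[n a] Qa].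
  by move=> /(_ gQ zQ n); rewrite val_mon // coefZ coefXn eqxx mulr1.
have Ia : Ip n a := QI _ Qa; split=> //; apply/of_formsP => // i.
rewrite val_mon // coefZ coefXn; case: eqP => [->|_]; first by rewrite mulr1.
by rewrite mulr0; apply: graded0 gQ.
Qed.

Lemma forms_graded (S : set R) : is_ideal S -> graded I (forms S).
Proof.
move=> idS; split=> [n|x []//|i j a b [Ia Sa] Ib]; last first.
  split; first exact: (ideal_pow_mul Ia Ib).
  by rewrite monM // clsM; apply: idealMC.
split=> [|a b [Ia Sa] [Ib Sb]|a b [Ib Sb]].
- split; first exact: ideal_pow0.
  by rewrite mon0 cls0; apply: ideal0.
- split; first exact: ideal_powD.
  by rewrite monD // clsD; apply: idealD.
- split; first exact: ideal_powMl.
  by rewrite -[n]add0n monM // clsM; apply: idealM.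
Qed.

(** Primality tested on forms extends to all elements: if r and s have their lowest coefficients
    outside Q in degrees i and j, the coefficient of rs in degree i + j is the product of these two
    modulo Q. *)
Lemma of_forms_prime Q : gpoint m I Q -> is_prime (of_forms Q).
Proof.
move=> QQ; have gQ := gpoint_graded QQ; have [[_ pQ] zQ _] := QQ.
have [idQ _ QM] := gQ; have inP r := of_formsP r gQ zQ; split.
- split; first by rewrite -cls0; apply/inP => i; rewrite raddf0 coef0; apply: graded0 gQ.
    move=> _ _ [r Qr <-] [s Qs <-]; rewrite -clsD; apply/inP => i.
    by rewrite (raddfD \val) coefD; apply: (idealD (idQ i)).
  move=> x _ [s Qs <-]; have [r ->] := cls_surj x; rewrite -clsM; apply/inP => i.
  rewrite (rmorphM \val) mulrC coefM; apply: (ideal_sum (J := slice Q i)) => // j _.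
  have ji : (j <= i)%N by rewrite -ltnS.
  by rewrite /slice /= -[X in Q (X, _)](subnKC ji); apply: QM => //; apply: rees_coef.
- rewrite -cls1 => /inP /(_ 0%N); rewrite rmorph1 coef1 /=; exact: gpoint1 QQ.
move=> x y; have [r ->] := cls_surj x; have [s ->] := cls_surj y.
rewrite -clsM => /inP Qrs; apply: contrapT => /not_orP[/inP nr /inP ns].
have least (t : rees I) : ~ (forall i, Q (i, (val t)`_i)) ->
    exists2 i, ~ Q (i, (val t)`_i) & forall j, (j < i)%N -> Q (j, (val t)`_j).
  move=> /existsNP[i0 hi0].
  have ex : exists i, `[< ~ Q (i, (val t)`_i) >] by exists i0; apply/asboolP.
  exists (ex_minn ex); case: ex_minnP => i /asboolP // hi min j ji.
  apply: contrapT => hj; have := min j; rewrite leqNgt ji => /(_ _)/negP[] //.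
  exact/asboolP.
have [i nri lti] := least r nr; have [j nsj ltj] := least s ns.
have := Qrs (i + j)%N; rewrite (rmorphM \val) coefM.
have ij : (i < (i + j).+1)%N by rewrite ltnS leq_addr.
rewrite (bigD1 (Ordinal ij)) //= addKn; set S := (X in _ + X) => Qsum.
have QS : slice Q (i + j)%N S.
  rewrite /S; apply: (ideal_sum (J := slice Q (i + j)%N)) => // k; rewrite -val_eqE /= => ki.
  have kij : (k <= i + j)%N by rewrite -ltnS.
  have rk := rees_coef r k; have sk := rees_coef s (i + j - k)%N.
  rewrite /slice /= -[X in Q (X, _)](subnKC kij).
  have [ltki|leik] := ltnP k i; first by apply: QM => //; apply: lti.
  by rewrite addnC mulrC; apply: QM => //; apply: ltj; lia.
have : Q ((i + j)%N, (val r)`_i * (val s)`_j).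
  by rewrite -[_ * _](addrK S); apply: (idealB (idQ (i + j)%N)).
by move=> /(gpoint_prime QQ (rees_coef r i) (rees_coef s j))[].
Qed.

Lemma homogeneous_cls (x : fiber_cone m I) n : gr_part n x <->
  exists2 a, Ip n a & x = cls (mon (n, a)).
Proof.
split=> [/fiber_partP[r -> [a ra]]|[a Ia ->]].
  have Ia : Ip n a by have := rees_coef r n; rewrite ra coefZ coefXn eqxx mulr1.
  by exists a => //; congr cls; apply: val_inj; rewrite val_mon.
by apply/fiber_partP; exists (mon (n, a)) => //; exists a; apply: val_mon.
Qed.

Definition pset (P : X) : set R := [set x | (x : fiber_cone m I) \in (P : prime_idealr _)].

Lemma pset_prime P : is_prime (pset P).
Proof. exact: prime_idealr_prime. Qed.

Lemma pset_forms P : pset P = of_forms (forms (pset P)).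
Proof.
have [idP _ _] := pset_prime P; apply/seteqP; split=> x.
  have [r ->] := cls_surj x => Pr; exists r => // i; split; first exact: rees_coef.
  have [n [c [hc e]]] := proj_homogeneous Pr.
  have /choice[a ha] : forall j, exists a, Ip j a /\ c j = cls (mon (j, a)).
    by move=> j; have [/homogeneous_cls[b Ib ->] _] := hc j; exists b.
  (* [s] lifts the same class through homogeneous components in P, so each coefficient of r differs
     from that of s by an element of mI^i, whose class vanishes. *)
  pose s := \sum_(j < n) mon (j : nat, a j).
  have : gzero m I (i, (val (r - s))`_i).
    move: i; apply/cls_eq0; rewrite clsB e cls_sum; apply/eqP; rewrite subr_eq0; apply/eqP.
    by apply: eq_bigr => j _; case: (ha j).
  have coefs : (val s)`_i = if (i < n)%N then a i else 0.
    rewrite (raddf_sum \val) coef_sum; case: ifP => [lin|nlin].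
      rewrite (bigD1 (Ordinal lin)) //= big1 ?addr0.
        by rewrite val_mon ?coefZ ?coefXn ?eqxx ?mulr1 //; case: (ha i).
      move=> j; rewrite -val_eqE /= => ji; rewrite val_mon ?coefZ ?coefXn; last by case: (ha j).
      by rewrite eq_sym (negPf ji) mulr0.
    apply: big1 => j _; rewrite /= val_mon ?coefZ ?coefXn; last by case: (ha j).
    by case: eqP => [ij|_]; [rewrite ij ltn_ord in nlin|rewrite mulr0].
  rewrite (raddfB \val) coefB coefs => /gzero_cls e0.
  have Pa : pset P (cls (mon (i, if (i < n)%N then a i else 0))).
    case: ifP => _; last by rewrite mon0 cls0; apply: ideal0.
    by case: (ha i) => _ <-; case: (hc i).
  have Ia : Ip i (if (i < n)%N then a i else 0).
    by case: ifP => _; [case: (ha i)|exact: ideal_pow0].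
  rewrite -[(val r)`_i](subrK (if (i < n)%N then a i else 0)) monD //; last first.
    by apply: ideal_powD; [exact: rees_coef|exact: ideal_powN].
  by rewrite clsD e0 add0r.
move=> [r Pr <-]; rewrite [r]rees_sum cls_sum; apply: ideal_sum => // i _.
by have [] := Pr i.
Qed.

Lemma forms_gpoint P : gpoint m I (forms (pset P)).
Proof.
have [idP nP1 pP] := pset_prime P; split.
- split; first exact: forms_graded.
  move=> [i a] [j b] Ia Ib [_]; rewrite /gop /= monM // clsM => /pP[Pa|Pb].
    by left.
  by right.
- move=> x zx; have [_ zI _] := @gzero_graded A m I; split; first exact: zI.
  by rewrite (gzero_cls zx); apply: ideal0.
(* The fiber cone is generated in degree one: a prime containing all of that degree would contain
   every form of positive degree. *)
- apply: contrapT => hI.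
  have gF := forms_graded idP.
  have FI x : x \in I -> forms (pset P) (1%N, x).
    by move=> Ix; apply: contrapT => nF; apply: hI; exists x.
  have [n [x [n0 /homogeneous_cls[a Ia ->] /negP]]] := proj_relevant P; apply.
  suff : Ip n `<=` slice (forms (pset P)) n by move=> /(_ a Ia)[].
  case: n n0 {x a Ia} => // n _; have [idF _ _] := gF.
  apply: ideal_mul_le => // x y /FI Fx Iy; rewrite /slice /= -[n.+1]add1n.
  exact: (gradedM gF Fx Iy).
Qed.

Lemma proj_inj P P' : forms (pset P) = forms (pset P') -> P = P'.
Proof.
move=> e; have : pset P = pset P' by rewrite pset_forms e -pset_forms.
case: P P' {e} => [K hK rK] [K' hK' rK'] /prime_idealr_inj /= e.
by move: hK' rK'; rewrite -e => hK' rK'; congr MkProj; exact: Prop_irrelevance.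
Qed.

Lemma gpoint_proj Q : gpoint m I Q ->
  exists P, pset P = of_forms Q /\ forms (pset P) = Q.
Proof.
move=> QQ; have gQ := gpoint_graded QQ; have [_ zQ [x Ix nQx]] := QQ.
have [K eK] := mk_prime (of_forms_prime QQ); have [idK _ _] := prime_idealr_prime K.
have hK : @homogeneous_ideal (fiber_cone m I) K.
  move=> y yK; have : of_forms Q y by rewrite -eK.
  have [r ->] := cls_surj y => /of_formsP Qr.
  have hr i : Q (i, (val r)`_i) by apply: Qr.
  exists (size (val r)), (fun i => cls (mon (i, (val r)`_i))); split=> [i|].
    split; first by apply/homogeneous_cls; exists (val r)`_i => //; apply: rees_coef.
    suff : [set` K] (cls (mon (i, (val r)`_i))) by [].
    have : forms (of_forms Q) (i, (val r)`_i) by rewrite of_formsK.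
    by case; rewrite eK.
  by rewrite {1}[r]rees_sum cls_sum.
have rK : exists n (y : fiber_cone m I), [/\ (0 < n)%N, gr_part n y & (y : R) \notin K].
  exists 1%N, (cls (mon (1%N, x))); split=> //.
    by apply/homogeneous_cls; exists x => //; apply: ideal_pow1_mem.
  apply/negP => xK; apply: nQx; rewrite -(of_formsK gQ zQ); split.
    exact: ideal_pow1_mem.
  by rewrite -eK.
exists (MkProj hK rK); have e : pset (MkProj hK rK) = of_forms Q by exact: eK.
by split=> //; rewrite e of_formsK.
Qed.

Lemma forms_le P (E : set R) : (forall x, E x -> homogeneous (x : fiber_cone m I)) ->
  E `<=` pset P <-> forms E `<=` forms (pset P).
Proof.
move=> hE; split=> [EP x [Ix /EP Px] //|EP x Ex].
have [n /homogeneous_cls[a Ia ea]] := hE x Ex; rewrite ea.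
by have [] : forms (pset P) (n, a) by apply: EP; split=> //; rewrite -ea.
Qed.

Definition pclosed (Q : set (nat * A)) : set X := [set P | Q `<=` forms (pset P)].

Lemma pclosedP (C : set X) :
  closed C <-> exists2 Q, Q `<=` gcarrier I & C = pclosed Q.
Proof.
rewrite -openC; split.
- move=> [E hE eE]; exists (forms E); first by move=> x [].
  rewrite -[C]setCK eE setCK.
  apply/seteqP; split=> P; first by move=> EP; apply/forms_le.
  by move=> EP; apply/forms_le.
- move=> [Q QI ->]; exists [set cls (mon x) | x in Q].
    by move=> _ [[n a] /QI Ia <-]; exists n; apply/homogeneous_cls; exists a.
  congr (~` _); apply/seteqP; split=> P /=; first by move=> QP _ [x /QP[] ? ? <-].
  by move=> QP x Qx; split; [exact: QI|apply: QP; exists x].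
Qed.

(** The forms vanishing on Z; for irreducible Z this is the generic point of its closure. *)
Definition generic (Z : set X) : set (nat * A) :=
  [set x | gcarrier I x /\ forall P, Z P -> forms (pset P) x].

Lemma closed_generic (C : set X) : closed C -> C = pclosed (generic C).
Proof.
move=> /pclosedP[Q QI eC]; apply/seteqP; split=> [P CP x [_]|P gP]; first exact.
by rewrite eC => x Qx; apply: gP; split=> [|P']; [exact: QI|rewrite eC; apply].
Qed.

Lemma generic_gpoint (Z : set X) : irreducible_set Z -> gpoint m I (generic Z).
Proof.
move=> [[P0 ZP0] irr]; have gF P := gpoint_graded (forms_gpoint P).
have gZ : graded I (generic Z).
  split=> [n|x []//|i j a b [Ia Za] Ib]; last first.
    by split=> [|P ZP]; [exact: (ideal_pow_mul Ia Ib)|apply: (gradedM (gF P)) => //; apply: Za].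
  split=> [|a b [Ia Za] [Ib Zb]|a b [Ib Zb]].
  - by split=> [|P _]; [exact: ideal_pow0|exact: graded0 (gF P)].
  - split=> [|P ZP]; first exact: ideal_powD.
    by have [idP _ _] := gF P; apply: (idealD (idP n)); [exact: Za|exact: Zb].
  - split=> [|P ZP]; first exact: ideal_powMl.
    by have [idP _ _] := gF P; apply: (idealM _ (idP n)); exact: Zb.
split.
- split=> // x y Ix Iy [_ Zxy].
  have cl u : gcarrier I u -> closed (pclosed [set u]).
    by move=> Iu; apply/pclosedP; exists [set u] => // _ ->.
  have [|ZC|ZC] := irr _ _ (cl x Ix) (cl y Iy).
  + move=> P ZP; have [[_ pP] _ _] := forms_gpoint P.
    by have [Px|Py] := pP x y Ix Iy (Zxy P ZP); [left|right] => _ ->.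
  + by left; split=> // P /ZC; apply.
  + by right; split=> // P /ZC; apply.
- move=> x zx; split=> [|P ZP]; first by apply: gradedU zx; apply: gzero_graded.
  by have [_ zP _] := forms_gpoint P; apply: zP.
- have [_ _ [x Ix nPx]] := forms_gpoint P0; exists x => //.
  by move=> [_ /(_ P0 ZP0)].
Qed.

Lemma gpoint_irreducible Q : gpoint m I Q ->
  closed (pclosed Q) /\ irreducible_set (pclosed Q).
Proof.
move=> QQ; have [P [_ eP]] := gpoint_proj QQ.
have QP : pclosed Q P by rewrite /pclosed /= eP.
split; first by apply/pclosedP; exists Q => //; apply: gradedU (gpoint_graded QQ).
split; first by exists P.
move=> C D /pclosedP[E _ ->] /pclosedP[F _ ->] sub.
by have := sub P QP; rewrite /pclosed /= eP => -[EQ|FQ]; [left|right] => P' /=;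
  apply: subset_trans.
Qed.

(** Irreducible closed sets and points of the fiber cone correspond by generic points and zero loci,
    both reversing inclusions. *)
Lemma top_dim_gpoint (e : int) : -1 <= e ->
  (forall n : nat, (exists Q, chain (@proper _) (gpoint m I) n Q) <-> n%:Z <= e) ->
  top_dim X e.
Proof.
move=> e1 h; apply/longest_chainP; split=> // n; rewrite -h; split=> -[z].
- move=> cz; suff c : chain (fun U V => V `<` U) (gpoint m I) n (generic z).
    exact: chain_rev c.
  apply: chain_map cz => [Z [_ irr]|Z Z' [cZ _] [cZ' _] [ZZ' nZZ']].
    exact: generic_gpoint.
  split=> [x [Ix Z'x]|sub]; first by split=> // P /ZZ' /Z'x.
  apply: nZZ'; rewrite (closed_generic cZ) (closed_generic cZ') => P.
  exact: subset_trans.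
- move=> cz; have [w cw] := chain_rev cz; exists (pclosed w).
  apply: chain_map cw => [Q|Q Q' QQ QQ' [sub nsub]]; first exact: gpoint_irreducible.
  split=> [P|sub']; first exact: subset_trans.
  have [P [_ eP]] := gpoint_proj QQ'; apply: nsub.
  by have := sub' P; rewrite /pclosed /= eP; apply.
Qed.

(** The closure of a point consists of the points whose ideals contain its own. *)
Lemma closed_pointP P : closed [set P] <->
  forall Q, gpoint m I Q -> forms (pset P) `<=` Q -> Q = forms (pset P).
Proof.
split=> [/closed_generic e Q /gpoint_proj[P' [_ <-]] PQ|h].
  suff -> : P' = P by [].
  suff : [set P] P' by [].
  by rewrite e => x [_ /(_ P erefl)]; apply: PQ.
apply/pclosedP; exists (forms (pset P)); first by move=> x [].
apply/seteqP; split=> [_ -> //|P' PP'].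
by apply: proj_inj; apply: h => //; apply: forms_gpoint.
Qed.

End ProjPoints.

(** * Closed points and ideals of colength one *)

Section Points.
Variables (A : comNzRingType) (m I : idealr A).
Local Notation Ip := (ideal_pow [set` I]).
Implicit Types (P Q : set (nat * A)) (J : set A) (x y z : A).
Hypotheses (nA : noeth A) (locA : local_with m).

(* The forms of the ideal [WR], for [W = J / mI]; in degree [0] they are those of the zero
   ideal of the fiber cone. *)
Definition cone_forms (J : set A) : set (nat * A) :=
  [set x | if x.1 is n.+1 then ideal_mul J (Ip n) x.2 else x.2 \in m].

Lemma cone_forms_graded J : is_ideal J -> J `<=` [set` I] ->
  ideal_mul [set` m] [set` I] `<=` J -> graded I (cone_forms J).
Proof.
move=> idJ JI mIJ; split.
- by case=> [|n]; [exact: idealr_ideal|exact: ideal_mul_ideal].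
- move=> [[|n] a] //=; apply: ideal_mul_le => [|x y Jx Iy].
    exact: ideal_mul_ideal.
  by apply: ideal_mul_mem => //; apply: JI.
- case=> [|i] j a b /=.
    move=> am; rewrite /cone_forms /=; case: j => [_|j]; first exact: (idealMC _ (idealr_ideal m)).
    move: b; apply: (ideal_mul_le (J := [set b | ideal_mul J (Ip j) (a * b)])) => [|x y Ix Iy].
      have := colon_ideal a (ideal_mul_ideal J (Ip j)); rewrite /colon.
      by congr is_ideal; apply/seteqP; split=> x /=; rewrite mulrC.
    by rewrite /= mulrA; apply: ideal_mul_mem => //; apply/mIJ/ideal_mul_mem.
  rewrite /cone_forms /= => Ja Ib; move: a Ja.
  apply: (ideal_mul_le (J := colon (ideal_mul J (Ip (i + j))) b)) => [|x y Jx Iy].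
    exact/colon_ideal/ideal_mul_ideal.
  by rewrite /colon /= -mulrA; apply: ideal_mul_mem => //; apply: ideal_pow_mul.
Qed.

Lemma cone_forms1 J : is_ideal J -> slice (cone_forms J) 1 = J.
Proof.
move=> idJ; apply/seteqP; split.
  by apply: ideal_mul_le => // x y Jx _; apply: idealMC.
by move=> x Jx; rewrite -[x]mulr1; apply: ideal_mul_mem.
Qed.

Lemma ideal_pow_adjoin J z n : is_ideal J -> J `<=` [set` I] ->
  ideal_mul [set` m] [set` I] `<=` J -> z \in I -> [set` I] `<=` adjoin J z ->
  Ip n `<=` adjoin (slice (cone_forms J) n) (z ^+ n).
Proof.
move=> idJ JI mIJ Iz IJz; have gF := cone_forms_graded idJ JI mIJ; have [idF FI FM] := gF.
elim: n => [x _|n IH].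
  apply/adjoinP; exists 0; first exact: (idealr0 m).
  by exists x; rewrite expr0 mulr1 add0r.
apply: ideal_mul_le => [|x y /IJz /adjoinP[j Jj [a ->]] Iy]; first exact: adjoin_ideal.
rewrite mulrDl; apply: idealD; first exact: adjoin_ideal.
  by apply: sub_adjoin; apply: ideal_mul_mem.
have /adjoinP[u Fu [c ->]] := IH y Iy; apply/adjoinP.
exists (a * z * u); last by exists (a * c); rewrite mulrDr exprS; congr (_ + _); rewrite mulrACA.
rewrite -mulrA mulrC [z * u]mulrC; apply: (idealMC _ (idF _)).
by rewrite /slice /= -addn1; apply: FM => //; apply: ideal_pow1_mem.
Qed.

(** A form outside WR is u + c z^n with u in WR and c a unit of [A], so products of such forms stay
    outside. A point with a form outside WR would contain z^n, hence z, hence all of degree one. *)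
Lemma cone_forms_gpoint J z : is_ideal J -> J `<=` [set` I] ->
  ideal_mul [set` m] [set` I] `<=` J -> z \in I -> [set` I] `<=` adjoin J z ->
  (forall n, ~ cone_forms J (n, z ^+ n)) ->
  gpoint m I (cone_forms J) /\
  forall Q, gpoint m I Q -> cone_forms J `<=` Q -> Q = cone_forms J.
Proof.
move=> idJ JI mIJ Iz IJz nz; have gF := cone_forms_graded idJ JI mIJ.
have [idF FI FM] := gF.
have Iz1 : [set` I] z := Iz.
have key n x : Ip n x -> ~ cone_forms J (n, x) ->
    exists2 u, cone_forms J (n, u) & exists c d, x = u + c * z ^+ n /\ d * c = 1.
  move=> Ix nFx; have /adjoinP[u Fu [c e]] := ideal_pow_adjoin idJ JI mIJ Iz IJz Ix.
  exists u => //; exists c.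
  have [|d cd] := local_unit nA locA (x := c); last by exists d; rewrite (mulrC d).
  apply/negP => cm; apply: nFx; rewrite e; apply: (idealD (idF n)) => //.
  by rewrite /slice /= -[n]add0n; apply: FM => //; apply: ideal_pow_exp.
have pF : gpoint m I (cone_forms J).
  split.
  - split=> // -[i x] [j y] Ix Iy Fxy; apply: contrapT => /not_orP[nFx nFy].
    have [u Fu [c [c' [ex cc']]]] := key i x Ix nFx.
    have [v Fv [d [d' [ey dd']]]] := key j y Iy nFy.
    apply: (nz (i + j)%N).
    have Fz : cone_forms J ((i + j)%N, c * d * z ^+ (i + j)).
      have -> : c * d * z ^+ (i + j) = x * y - u * y - c * z ^+ i * v.
        rewrite exprD mulrACA.
        have -> : d * z ^+ j = y - v by rewrite ey addrC addKr.
        by rewrite mulrBr; congr (_ - _); rewrite -mulrBl ex [u + _]addrC addrK.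
      apply: (idealB (idF _)); first by apply: (idealB (idF _)) => //; apply: FM.
      rewrite /slice /= addnC mulrC; apply: FM => //; apply: ideal_powMl; exact: ideal_pow_exp.
    have -> : z ^+ (i + j) = (c' * d') * (c * d * z ^+ (i + j)).
      by rewrite mulrA mulrACA cc' dd' !mul1r.
    exact: (idealM _ (idF _)).
  - move=> [[|n] a] /= za.
      suff : ideal_mul [set` m] setT `<=` [set` m] by apply.
      apply: ideal_mul_le => [|x y xm _]; first exact: idealr_ideal.
      exact: (idealMC _ (idealr_ideal m)).
    suff : ideal_mul [set` m] (Ip n.+1) `<=` slice (cone_forms J) n.+1 by apply.
    apply: ideal_mul_le => [|x y xm Iy]; first exact: idF.
    by rewrite /slice /= -[n.+1]add0n; apply: FM.
  - by exists z => // Fz; apply: (nz 1%N).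
split=> // Q QQ FQ; apply/seteqP; split=> // -[n x] Qx; apply: contrapT => nFx.
have [idQ QI QM] := gpoint_graded QQ.
have [u Fu [c [d [ex dc]]]] := key n x (QI _ Qx) nFx.
have Qzn : Q (n, z ^+ n).
  have -> : z ^+ n = d * (x - u) by rewrite ex addrC addKr mulrA dc mul1r.
  by apply: (idealM _ (idQ n)); apply: (idealB (idQ n)) => //; apply: FQ.
have Qz : Q (1%N, z) by apply: (gpoint_exp QQ (k := n)); rewrite ?muln1 //; exact: ideal_pow1_mem.
have [_ _ [w Iw]] := QQ; apply.
suff : adjoin J z `<=` slice Q 1 by apply; apply: IJz.
by apply: adjoin_min => // y Jy; apply: FQ; rewrite -[cone_forms J _]/(slice _ 1 y) cone_forms1.
Qed.

(** Expansion of (J + Az)^n by powers of z, the coefficient of z^(n - i) lying in J^i. *)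
Lemma ideal_pow_integral J z n : is_ideal J -> [set` I] `<=` adjoin J z ->
  Ip n `<=` [set y | exists2 b : nat -> A, (forall i, ideal_pow J i (b i)) &
               y = \sum_(i < n.+1) b i * z ^+ (n - i)].
Proof.
move=> idJ IJz; pose V k := [set y | exists2 b : nat -> A, (forall i, ideal_pow J i (b i)) &
  y = \sum_(i < k.+1) b i * z ^+ (k - i)]; rewrite -/(V n).
have idV k : is_ideal (V k).
  split.
  - exists (fun=> 0) => [i|]; first exact: ideal_pow0.
    by rewrite big1 // => i _; rewrite mul0r.
  - move=> x y [b hb ->] [c hc ->]; exists (fun i => b i + c i) => [i|].
      exact: ideal_powD.
    by rewrite -big_split; apply: eq_bigr => i _; rewrite mulrDl.
  - move=> a x [b hb ->]; exists (fun i => a * b i) => [i|]; first exact: ideal_powMl.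
    by rewrite mulr_sumr; apply: eq_bigr => i _; rewrite mulrA.
have term k i b : (i <= k)%N -> ideal_pow J i b -> V k (b * z ^+ (k - i)).
  move=> ik Jb; exists (fun j => if j == i then b else 0) => [j|].
    by case: eqP => [->|_] //; apply: ideal_pow0.
  rewrite -ltnS in ik; rewrite (bigD1 (Ordinal ik)) //= eqxx big1 ?addr0 // => j.
  by rewrite -val_eqE /= => /negPf ->; rewrite mul0r.
elim: n => [x _|n IH].
  by exists (fun i => if i is 0%N then x else 0) => [[|i]|];
    rewrite ?big_ord1 ?mulr1 //; apply: ideal_pow0.
apply: ideal_mul_le => // x y /IJz /adjoinP[j Jj [a ->]] /IH[b hb ->].
rewrite mulrDl !mulr_sumr; apply: (idealD (idV _)); apply: (ideal_sum (J := V n.+1)) => // i _.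
  rewrite mulrA -subSS; apply: term; first exact: ltn_ord.
  exact: (ideal_mul_mem Jj (hb i)).
have -> : a * z * (b i * z ^+ (n - i)) = a * (b i * z ^+ (n.+1 - i)).
  by rewrite subSn -1?ltnS // exprS -mulrA; congr (a * _); rewrite mulrCA.
by apply: (idealM _ (idV _)); apply: term => //; apply: ltnW.
Qed.

Lemma cone_forms_integral J z n : is_ideal J -> [set` I] `<=` adjoin J z ->
  cone_forms J (n, z ^+ n) -> integral_over_ideal J z.
Proof.
case: n => [|n] idJ IJz /=; first by rewrite /cone_forms /= expr0 idealr1.
rewrite /cone_forms /= => Fz.
suff [b hb e] : exists2 b : nat -> A, (forall i, ideal_pow J i.+1 (b i)) &
    z ^+ n.+1 = \sum_(i < n.+1) b i * z ^+ (n - i).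
  (* Dependence coefficients are numbered from 1, and moving the sum across the equation changes its
     sign. *)
  exists n.+1, (fun i => - b i.-1); split=> // [[|i] //= _|].
    exact: (ideal_powN (n := i.+1) (hb i)).
  rewrite big_add1 big_mkord /= e -big_split /= big1 // => i _.
  by rewrite subSS mulNr subrr.
move: Fz; apply: (ideal_mul_le (J := [set y | exists2 b : nat -> A,
  (forall i, ideal_pow J i.+1 (b i)) & y = \sum_(i < n.+1) b i * z ^+ (n - i)])).
  split.
  - exists (fun=> 0) => [i|]; first exact: ideal_pow0.
    by rewrite big1 // => i _; rewrite mul0r.
  - move=> x y [b hb ->] [c hc ->]; exists (fun i => b i + c i) => [i|].
      exact: ideal_powD.
    by rewrite -big_split; apply: eq_bigr => i _; rewrite mulrDl.
  - move=> a x [b hb ->]; exists (fun i => a * b i) => [i|]; first exact: ideal_powMl.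
    by rewrite mulr_sumr; apply: eq_bigr => i _; rewrite mulrA.
move=> x y Jx /(ideal_pow_integral idJ IJz)[b hb ->].
exists (fun i => x * b i) => [i|]; first exact: (ideal_mul_mem Jx (hb i)).
by rewrite mulr_sumr; apply: eq_bigr => i _; rewrite mulrA.
Qed.

(** Integral closedness of I first puts x in I. The coefficients then lie in powers of P_1, so the
    equation puts x^n in P, and primality gives x. *)
Lemma slice_integrally_closed P x : integrally_closed_ideal I -> gpoint m I P ->
  integral_over_ideal (slice P 1) x -> P (1%N, x).
Proof.
move=> clI PP [n [a [n0 ha e]]]; have gP := gpoint_graded PP; have [idP PI PM] := gP.
have PI1 : slice P 1 `<=` [set` I].
  by move=> y /PI; rewrite /= -[ideal_mul _ _]/(Ip 1) (ideal_pow1 (idealr_ideal I)).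
have Ix : x \in I.
  apply: clI; exists n, a; split=> // i hi; exact: ideal_pow_mono (ha i hi).
have Pk k y : ideal_pow (slice P 1) k.+1 y -> P (k.+1, y).
  have -> : P (k.+1, y) = slice P k.+1 y by [].
  move: y; apply: ideal_mul_le => // u v Pu /(ideal_pow_mono PI1) Iv.
  by rewrite /slice /= -add1n; apply: PM.
have Ix1 := ideal_pow1_mem Ix.
apply: (gpoint_exp PP Ix1 (k := n)); rewrite muln1.
have -> : x ^+ n = - \sum_(1 <= i < n.+1) a i * x ^+ (n - i).
  by apply/eqP; rewrite -addr_eq0 e.
apply: (idealN (idP n)); rewrite big_nat; apply: (ideal_sum (J := slice P n)) => // -[|i] //.
rewrite ltnS => /andP[_ lin].
have hai : ideal_pow (slice P 1) i.+1 (a i.+1) by apply: ha; apply/andP; split.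
have := PM _ _ _ _ (Pk _ _ hai) (ideal_pow_exp (n - i.+1) (Ix : [set` I] x)).
by rewrite subnKC.
Qed.

(* A homogeneous form [q(s, z)] over an algebraically closed field is a product of
   linear forms [s - c z], one of which lies in the prime [P]. *)
Lemma linear_factor P (s z : A) r (q : {poly A}) :
  GRing.closed_field_axiom {ideal_quot m} -> gpoint m I P -> s \in I -> z \in I ->
  (size q <= r.+1)%N -> q`_r = 1 ->
  P (r, \sum_(i < r.+1) q`_i * (s ^+ i * z ^+ (r - i))) ->
  exists c, P (1%N, s - c * z).
Proof.
move=> clk PP Is Iz; have gP := gpoint_graded PP; have [idP PI PM] := gP.
have Is1 : [set` I] s := Is; have Iz1 : [set` I] z := Iz.
pose hom r (q : {poly A}) := \sum_(i < r.+1) q`_i * (s ^+ i * z ^+ (r - i)).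
have homI r' q' : Ip r' (hom r' q').
  rewrite /hom; apply: (ideal_sum (J := Ip r')) => [|i _]; first exact: ideal_pow_ideal.
  apply: ideal_powMl.
  have ir : (i <= r')%N by rewrite -ltnS.
  rewrite -[X in ideal_pow _ X](subnKC ir).
  by apply: ideal_pow_mul; apply: ideal_pow_exp.
rewrite -[\sum_(_ < _) _]/(hom r q); elim: r q => [|r IH] q szq qr.
  by rewrite /hom big_ord1 qr !mulr1 => /(gpoint1 PP).
pose pr (a : A) : {ideal_quot m} := \pi_{ideal_quot m} a.
(* The axiom solves x^n = sum of p_i x^i; the signs are reversed to obtain a root of the monic q
   modulo [m]. *)
have [x0 ex0] := clk r.+1 (fun i => pr (- q`_i)) (ltn0Sn r).
have [rho erho] : exists rho, x0 = pr rho by exists (repr x0); rewrite /pr reprK.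
have qrho : q.[rho] \in m.
  rewrite -[q.[rho]]subr0 Quotient.idealrBE; apply/eqP.
  rewrite -/(pr _) -/(pr 0) (horner_coef_wide _ szq) big_ord_recr /= qr mul1r.
  have prD a b : pr (a + b) = pr a + pr b by rewrite /pr raddfD.
  have prX a n : pr (a ^+ n) = pr a ^+ n by rewrite /pr rmorphXn.
  have prM a b : pr (a * b) = pr a * pr b by rewrite /pr rmorphM.
  have prS n (f : 'I_n -> A) : pr (\sum_(i < n) f i) = \sum_(i < n) pr (f i).
    by rewrite /pr raddf_sum.
  rewrite prD prX -erho ex0 prS -big_split /= big1 ?[pr 0]raddf0 // => i _.
  by rewrite prM prX -erho -mulrDl -prD subrr [pr 0]raddf0 mul0r.
(* Division takes place over [A], leaving the remainder q(rho) in [m]; as P contains [m] in degree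
   zero, the form splits modulo P. *)
have [q1 eq1] : exists q1, q - q.[rho]%:P = q1 * ('X - rho%:P).
  by apply/factor_theorem; rewrite /root !hornerE subrr.
have szq1 : (size q1 <= r.+1)%N.
  have [->|q10] := eqVneq q1 0; first by rewrite size_poly0.
  have : (size (q - q.[rho]%:P)%R <= r.+2)%N.
    rewrite (leq_trans (size_polyD _ _)) // geq_max szq size_polyN.
    by rewrite (leq_trans (size_polyC_leq1 _)).
  by rewrite eq1 size_Mmonic ?monicXsubC // size_XsubC addn2.
have coefq i : q`_i = (if i is j.+1 then q1`_j else q.[rho]) - rho * q1`_i.
  have := congr1 (fun p : {poly A} => p`_i) eq1.
  rewrite /= mulrBr !coefB coefMX coefMC coefC => /(canRL (subrK _)) ->.
  by case: i => [|i] /=; [rewrite sub0r addrC mulrC|rewrite addr0 [rho * _]mulrC].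
have q1r : q1`_r = 1.
  have := coefq r.+1; rewrite qr [q1`_r.+1]nth_default // mulr0 subr0 => ->.
  by [].
have Phom : hom r.+1 q = (s - rho * z) * hom r q1 + q.[rho] * z ^+ r.+1.
  rewrite /hom; under eq_bigr => i _ do rewrite coefq mulrBl.
  rewrite sumrB big_ord_recl /= expr0 mul1r subn0 [RHS]addrC mulrBl -!addrA; congr (_ + _).
  congr (_ - _).
    rewrite mulr_sumr; apply: eq_bigr => i _ /=.
    by rewrite /bump /= add1n subSS exprS -mulrA mulrCA.
  rewrite big_ord_recr /= [q1`_r.+1]nth_default // mulr0 mul0r addr0 mulr_sumr.
  apply: eq_bigr => i _; rewrite subSn -1?ltnS // exprS -!mulrA; congr (rho * _).
  by rewrite [RHS]mulrCA; congr (_ * _); rewrite mulrCA.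
rewrite Phom => Ph.
have {Ph} : P ((1 + r)%N, (s - rho * z) * hom r q1).
  rewrite add1n -[_ * _](addrK (q.[rho] * z ^+ r.+1)).
  apply: (idealB (idP r.+1)) => //; rewrite /slice /= -[r.+1]add0n.
  by apply: PM; [apply/(gpoint0 nA locA _ PP)|rewrite add0n; apply: ideal_pow_exp].
move=> /(gpoint_prime PP _ (homI r q1))[||/(IH q1 szq1 q1r)//]; last by exists rho.
by apply: ideal_pow1_mem; apply: (rpredB (S := I)) => //; apply: idealMr.
Qed.

(* Modulo [P], multiplication by [s / z] is an endomorphism of the finite module
   [I^M / P_M] for large [M]; a relation between the iterates of [z^M] gives a monic form
   in [s] and [z] lying in [P]. *)
Lemma maximal_gpoint_line P (s z : A) : GRing.closed_field_axiom {ideal_quot m} ->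
  gpoint m I P -> (forall Q, gpoint m I Q -> P `<=` Q -> Q = P) ->
  s \in I -> z \in I -> ~ P (1%N, z) -> exists c, P (1%N, s - c * z).
Proof.
move=> clk PP maxP Is Iz nPz; have gP := gpoint_graded PP; have [idP PI PM] := gP.
have Is1 := ideal_pow1_mem Is; have Iz1 := ideal_pow1_mem Iz.
have Izn k : Ip k (z ^+ k) by apply: ideal_pow_exp.
have Isn k : Ip k (s ^+ k) by apply: ideal_pow_exp.
have [r hr] : exists r, Ip r `<=` slice (gadj I P (1%N, z)) r.
  apply: (ideal_pow_sub_decomposition nA (m := m)) => [||Q QQ sub].
  - exact: gadj_graded.
  - by have [_ zP _] := PP; apply: subset_trans zP _; apply: sub_gadj.
  - have QP := maxP Q QQ (subset_trans (@sub_gadj _ _ _ _) sub).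
    by apply: nPz; rewrite -QP; apply/sub/mem_gadj.
have [M hM] : exists M, forall a, Ip M.+1 a -> exists2 w, Ip M w & P (M.+1, a - z * w).
  case: r hr => [|M] hr; last first.
    exists M => a /hr[j Pj [w /princP hw /= <-]]; case: hw => [->|[k [y [/= eM Iy ->]]]].
      by exists 0; [exact: ideal_pow0|rewrite mulr0 subr0 addr0].
    by exists y; [have -> : M = k by [lia]|rewrite addrK].
  have [j Pj [w /princP[->|[k [y []//]]]]] := hr 1 Logic.I.
  by rewrite addr0 /= => e; case: (gpoint1 PP); rewrite -e.
have /choice[g hg] : forall v, exists w, Ip M v -> Ip M w /\ P (M.+1, s * v - z * w).
  move=> v; have [Iv|nIv] := pselect (Ip M v); last by exists 0.
  have [|w Iw Pw] := hM (s * v); last by exists w.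
  by rewrite -add1n; apply: ideal_pow_mul.
pose v i := iter i g (z ^+ M).
have Iv i : Ip M (v i) by elim: i => //= i /hg[].
have Pv i : P ((i + M)%N, s ^+ i * z ^+ M - z ^+ i * v i).
  elim: i => [|i IH]; first by rewrite !expr0 !mul1r subrr; apply: graded0 gP.
  have -> : s ^+ i.+1 * z ^+ M - z ^+ i.+1 * v i.+1 =
      (s ^+ i * z ^+ M - z ^+ i * v i) * s + (s * v i - z * v i.+1) * z ^+ i.
    rewrite !mulrBl addrA; congr (_ - _); last by rewrite exprS mulrAC.
    have -> : s * v i * z ^+ i = z ^+ i * v i * s by rewrite [s * _]mulrC mulrAC [v i * _]mulrC.
    by rewrite subrK exprSr mulrAC.
  apply: (idealD (idP _)); rewrite /slice /=.
    by rewrite -addn1 addnAC; apply: PM.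
  by rewrite addSnnS addnC; apply: PM => //; have [] := hg _ (Iv i).
(* I^M is an ideal of the Noetherian ring [A], so the spans of the iterates stabilise and some v_N
   is a combination of earlier ones. *)
have [|n|N hN] := noeth_acc nA (f := fun n => ideal_span [set v i | i in [set i | (i < n)%N]]).
- by move=> n; apply: ideal_span_ideal.
- by apply: ideal_span_mono => _ [i /= lin <-]; exists i => //=; apply: ltnW.
have [c ec] : exists c : nat -> A, v N = \sum_(i < N) c i * v i.
  have : ideal_span [set v i | i in [set i | (i < N.+1)%N]] (v N).
    by apply: ideal_span_sub; exists N => /=.
  rewrite (hN N.+1 (leqnSn N)).
  apply: (ideal_span_le (J := [set y | exists c : nat -> A, y = \sum_(i < N) c i * v i])).
    split=> [|x y [b ->] [d ->]|a x [b ->]].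
    - by exists (fun=> 0); rewrite big1 // => i _; rewrite mul0r.
    - by exists (fun i => b i + d i); rewrite -big_split; apply: eq_bigr => i _; rewrite mulrDl.
    - by exists (fun i => a * b i); rewrite mulr_sumr; apply: eq_bigr => i _; rewrite mulrA.
  move=> _ [i /= iN <-]; exists (fun j => if j == i then 1 else 0).
  rewrite (bigD1 (Ordinal iN)) //= eqxx mul1r big1 ?addr0 // => j.
  by rewrite -val_eqE /= => /negPf ->; rewrite mul0r.
pose q : {poly A} := 'X^N - \poly_(i < N) c i.
have qN : q`_N = 1 by rewrite coefB coefXn coef_poly eqxx ltnn subr0.
have szq : (size q <= N.+1)%N.
  rewrite (leq_trans (size_polyD _ _)) // geq_max size_polyXn leqnn size_polyN.
  by apply: leq_trans (size_poly _ _) _.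
apply: (linear_factor (r := N) (q := q)) => //.
have homI : Ip N (\sum_(i < N.+1) q`_i * (s ^+ i * z ^+ (N - i))).
  apply: (ideal_sum (J := Ip N)) => [|i _]; first exact: ideal_pow_ideal.
  apply: ideal_powMl; have iN : (i <= N)%N by rewrite -ltnS.
  by rewrite -[X in ideal_pow _ X](subnKC iN); apply: ideal_pow_mul.
(* Since z^i v_i equals s^i z^M modulo P, multiplying the relation by z^N turns it into q(s, z) z^M,
   and z^M cancels because z is outside P. *)
suff : P ((N + M)%N, (\sum_(i < N.+1) q`_i * (s ^+ i * z ^+ (N - i))) * z ^+ M).
  move=> /(gpoint_prime PP homI (Izn M))[//|Pz]; case: nPz.
  by apply: (gpoint_exp PP Iz1 (k := M)); rewrite muln1.
rewrite big_ord_recr /= qN mul1r subnn expr0 mulr1 addrC mulrDl mulr_suml.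
have -> : s ^+ N * z ^+ M = (s ^+ N * z ^+ M - z ^+ N * v N) + z ^+ N * v N.
  by rewrite subrK.
rewrite -addrA; apply: (idealD (idP _)); first exact: Pv.
rewrite ec mulr_sumr -big_split; apply: (ideal_sum (J := slice P (N + M)%N)) => // i _ /=.
have iN : (i <= N)%N by apply: ltnW.
have -> : z ^+ N * (c i * v i) + q`_i * (s ^+ i * z ^+ (N - i)) * z ^+ M =
    - c i * ((s ^+ i * z ^+ M - z ^+ i * v i) * z ^+ (N - i)).
  rewrite coefB coefXn coef_poly ltn_ord (ltn_eqF (ltn_ord i)) sub0r.
  rewrite -{1}(subnK iN) exprD mulrBl mulrBr addrC; congr (_ + _).
    by rewrite -mulrA; congr (_ * _); rewrite mulrAC.
  by rewrite mulNr opprK mulrCA; congr (_ * _); rewrite [RHS]mulrC mulrA.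
apply: (idealM _ (idP _)); rewrite /slice /=.
have -> : (N + M = i + M + (N - i))%N by lia.
by apply: PM.
Qed.

End Points.

(** * Submodules of I / I' and colength one *)

Lemma submodP (A : comNzRingType) (M : lmodType A) (Q : set M) :
  submod_closed (mem Q) <-> Q 0 /\ forall a x y, Q x -> Q y -> Q (a *: x + y).
Proof.
split=> [[Q0 QD]|[Q0 QD]].
  split=> [|a x y Qx Qy]; first by move: Q0; rewrite inE.
  by have := QD a x y; rewrite !inE; apply.
by split=> [|a x y]; rewrite ?inE //; apply: QD.
Qed.

Section Colength.
Variables (A : comNzRingType) (m I I' : idealr A).
Hypotheses (nA : noeth A) (locA : local_with m) (I'I : {subset I' <= I}).
Local Notation M := (ideal_quotient I I').

(* The class of [x] in [I / I']; it is the junk value [0] unless [x] is in [I]. *)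
Definition icls (x : A) : M := iq_pi I' (insubd (0 : ideal_mod I) (x : A^o)).

Lemma val_icls (x : A) : x \in I -> ideal_val (insubd (0 : ideal_mod I) (x : A^o)) = x.
Proof. by move=> xI; rewrite [LHS]val_insubd unfold_in xI. Qed.

Lemma icls_surj (u : M) : exists2 x, x \in I & u = icls x.
Proof.
rewrite -[u]iq_piK; set w := repr _; exists (val w : A); first exact: (valP w).
by congr iq_pi; apply: val_inj; rewrite /= val_icls //; exact: (valP w).
Qed.

Lemma icls_eq x y : x \in I -> y \in I -> icls x = icls y <-> x - y \in I'.
Proof.
move=> xI yI; rewrite /icls iq_pi_eq unfold_in /sub_ideal_pred.
have valB (u v : ideal_mod I) : (val (u - v) : A) = ideal_val u - ideal_val v.
  exact: (raddfB \val).
by rewrite valB !val_icls.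
Qed.

Lemma icls_lin a x y : x \in I -> y \in I -> a *: icls x + icls y = icls (a * x + y).
Proof.
move=> xI yI; have axI : a * x \in I by apply: idealMr.
have axyI : a * x + y \in I by apply: (rpredD (S := I)).
rewrite /icls -[_ *: iq_pi _ _]/(iq_scale a _) iq_piZ -iq_piD; congr iq_pi.
have valL (u v : ideal_mod I) : ideal_val (a *: u + v) = a * ideal_val u + ideal_val v.
  by have := linearP (\val : {linear ideal_mod I -> A^o}) a u v.
by apply: val_inj; apply: (etrans (valL _ _)); rewrite /= !val_icls.
Qed.

Lemma icls_eq0 x : x \in I -> icls x = 0 <-> x \in I'.
Proof.
move=> xI; have {1}<- : icls 0 = 0.
  have := icls_lin (-1) (idealr0 I) (idealr0 I).
  by rewrite mulr0 addr0 scaleN1r addNr.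
by rewrite icls_eq ?idealr0 // subr0.
Qed.

(** A nonzero quotient supplies z; an ideal strictly between I' and I would give a chain of length
    two through its image. *)
Lemma colength1_simple : module_length M 1 ->
  (exists2 z, z \in I & z \notin I') /\
  forall K : set A, is_ideal K -> [set` I'] `<=` K -> K `<=` [set` I] ->
    K `<=` [set` I'] \/ [set` I] `<=` K.
Proof.
move=> [_ h]; split.
  have [Z [FZ ZZ]] := (h 1%N).2 isT; have [_ /existsNP[u /not_implyP[Z1u nZ0u]]] := ZZ 0%N isT.
  have [z zI eu] := icls_surj u; exists z => //; apply/negP => zI'.
  apply: nZ0u; rewrite eu; have /(icls_eq0 zI) -> := zI'.
  by have /submodP[] := FZ 0%N isT.
move=> K idK I'K KI; apply: contrapT => /not_orP[].
move=> /existsNP[x /not_implyP[Kx /negP nx]] /existsNP[y /not_implyP[yI nKy]].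
have xI : x \in I := KI x Kx; have {}yI : y \in I := yI.
have := (h 2%N).1; suff c : exists Z : nat -> set M,
    (forall i, (i <= 2)%N -> submod_closed (mem (Z i))) /\
    (forall i, (i < 2)%N -> Z i `<` Z i.+1) by move=> /(_ c).
pose ZK := [set icls x | x in K].
exists (fun i => if i is 0%N then [set 0] else if i is 1%N then ZK else setT); split.
- move=> [|[|i]] _; apply/submodP; split=> //.
  + by move=> a u v -> ->; rewrite /= scaler0 addr0.
  + by exists 0; [exact: ideal0|apply/icls_eq0; exact: idealr0].
  + move=> a _ _ [u Ku <-] [v Kv <-]; exists (a * u + v).
      by apply: idealD => //; apply: idealM.
    by rewrite icls_lin //; apply: KI.
- move=> [|[|i]] // _; split=> //.
  + by move=> _ ->; exists 0; [exact: ideal0|apply/icls_eq0; exact: idealr0].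
  + by move=> /(_ (icls x)) -h2; case/negP: nx; apply/(icls_eq0 xI); apply: h2; exists x.
  + move=> /(_ (icls y) Logic.I)[w Kw]; move=> /(icls_eq (KI w Kw) yI) wy.
    apply: nKy; rewrite -[y](subKr w); apply: idealB => //; exact: I'K.
Qed.

(** Simplicity leaves I' + mI equal to I' or to I, and Nakayama rules out the latter; likewise I' +
    Az must be I. *)
Lemma colength1_adjoin : module_length M 1 ->
  [/\ exists2 z, z \in I & z \notin I',
      ideal_mul [set` m] [set` I] `<=` [set` I'] &
      forall z, z \in I -> z \notin I' -> [set` I] `<=` adjoin [set` I'] z].
Proof.
move=> /colength1_simple[[z0 z0I z0I'] simple].
have idI' := idealr_ideal I'; have idI := idealr_ideal I.
split; first by exists z0.
- have idmI := ideal_mul_ideal [set` m] [set` I].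
  have idK := add_ideal_ideal idI' idmI.
  have [||sub|sub] := simple _ idK; first exact: sub_add_ideall.
  + apply: add_ideal_min => //.
    by apply: ideal_mul_le => // x y _ yI; apply: idealMr.
  + by apply: subset_trans sub; apply: sub_add_idealr.
  + have [g eg] := nA idI.
    have Ig : gen [set` I'] g = [set` I].
      apply/seteqP; split; first apply: gen_min => // x xg.
        by have : [set` I] x by rewrite eg; apply: ideal_span_sub.
      by rewrite eg; apply: ideal_span_mono => x; right.
    have := nakayama nA locA (s := g) idI'; rewrite Ig => /(_ sub) h.
    by case/negP: z0I'; apply: h.
- move=> z zI zI'; have idK := adjoin_ideal z idI'.
  have [||sub|//] := simple _ idK; first exact: sub_adjoin.
    exact: adjoin_min.
  by case/negP: zI'; apply: sub; apply: mem_adjoin.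
Qed.

(** An element j + az of I outside I' has a a unit, because mI is inside I'. A nonzero submodule
    thus contains the class of z, which generates the quotient. *)
Lemma adjoin_colength1 z : z \in I -> z \notin I' ->
  ideal_mul [set` m] [set` I] `<=` [set` I'] ->
  [set` I] `<=` adjoin [set` I'] z -> module_length M 1.
Proof.
move=> zI zI' mI Iz; apply/longest_chainP; split=> // n.
have Zz (Z : set M) : submod_closed (mem Z) -> forall x, x \in I -> x \notin I' ->
    Z (icls x) -> Z = setT.
  move=> /submodP[Z0 ZD] x xI xI' Zx.
  have /adjoinP[j jI' [a ex]] := Iz x xI.
  have [|b ab] := local_unit nA locA (x := a).
    apply/negP => am; case/negP: xI'; rewrite ex; apply: (rpredD (S := I')) => //.
    by apply: mI; apply: ideal_mul_mem.
  have jI : j \in I by apply: I'I.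
  have baz : b * (a * z) = z by rewrite mulrA [b * a]mulrC ab mul1r.
  have Z_z : Z (icls z).
    have := ZD b _ _ Zx Z0; rewrite addr0.
    have : icls x = icls (a * z).
      apply/icls_eq => //; first exact: idealMr.
      by rewrite ex addrK.
    have azI : a * z \in I by apply: idealMr.
    move=> ->; have := icls_lin b azI (idealr0 I).
    by rewrite addr0 baz (icls_eq0 (idealr0 I)).2 ?idealr0 // addr0 => ->.
  apply/seteqP; split=> // u _; have [y yI ->] := icls_surj u.
  have /adjoinP[i iI' [c ->]] := Iz y yI.
  have iI : i \in I by apply: I'I.
  have -> : i + c * z = c * z + i by rewrite addrC.
  by rewrite -icls_lin //; apply: ZD => //; rewrite (icls_eq0 iI).2.
split=> [[w cw]|n1].
  have [Z [FZ ZZ _]] := chain_seq cw.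
  case: n cw FZ ZZ => [|[|n]] // _ FZ ZZ.
  have [_ /existsNP[u /not_implyP[Z1u nZ0u]]] := ZZ 0%N isT.
  have [x xI eu] := icls_surj u.
  have xI' : x \notin I'.
    apply/negP => xI'; apply: nZ0u; rewrite eu (icls_eq0 xI).2 //.
    by have /submodP[] := FZ 0%N isT.
  have [_] := ZZ 1%N isT; rewrite (Zz (Z 1%N) (FZ 1%N isT) x xI xI') -?eu //.
  by case.
apply: (@chain_pred _ _ _ 1%N n setT) => //.
apply: (chainS (z := [set 0])).
- by apply: chain0; apply/submodP; split=> // a u v -> ->; rewrite /= scaler0 addr0.
- split=> // /(_ (icls z) Logic.I) /(icls_eq0 zI); exact/negP.
- by apply/submodP.
Qed.

End Colength.

(** * The ideal WR degree by degree *)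

Section ConePoint.
Variables (A : comNzRingType) (m I : idealr A).
Local Notation Ip := (ideal_pow [set` I]).

(** Links the ideal generated by W in the fiber cone with its explicit graded pieces: coefficients
    in [m] die in degree zero, and degree n + 1 is spanned by products of J with I^n. *)
Lemma cone_pointE (J : idealr A) : {subset J <= I} ->
  ideal_mul [set` m] [set` I] `<=` [set` J] ->
  gpoint m I (cone_forms m I [set` J]) ->
  @cone_point A m I J = of_forms (cone_forms m I [set` J]).
Proof.
move=> JI mIJ pF; have idJ := idealr_ideal J.
have gF := gpoint_graded pF; have [idF FI FM] := gF; have [_ zF _] := pF.
have [idO _ _] := of_forms_prime pF.
set S : set (fiber_ring m I) := @cone_point A m I J.
have idS : is_ideal S by apply: ideal_span_ideal.
apply/seteqP; split.
  apply: ideal_span_le idO _ => _ [r [a Ja ra] <-].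
  apply/(of_formsP r gF zF) => i; rewrite ra coefZ coefXn.
  case: eqP => [->|_]; last by rewrite mulr0; apply: graded0 gF.
  by rewrite mulr1 -[cone_forms _ _ _ _]/(slice (cone_forms m I [set` J]) 1 a) cone_forms1.
move=> _ [r Fr <-]; rewrite [r]rees_sum cls_sum; apply: ideal_sum => // i _.
have gS := forms_graded idS.
suff : forms S (nat_of_ord i, (val r)`_i) by case.
case: (nat_of_ord i) (Fr i) => [|n] /= Fi.
  split=> //; rewrite gzero_cls; first exact: ideal0.
  by rewrite /gzero /= -[_`_0]mulr1; apply: ideal_mul_mem.
suff : ideal_mul [set` J] (Ip n) `<=` slice (forms S) n.+1 by apply.
have [idG _ GM] := gS; apply: ideal_mul_le => // x y Jx Iy.
rewrite /slice /= -[n.+1]add1n; apply: GM => //; split.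
  by apply: ideal_pow1_mem; apply: JI.
apply: ideal_span_sub; exists (mon I (1%N, x)) => //; exists x => //.
by apply: val_mon; apply: ideal_pow1_mem; apply: JI.
Qed.

End ConePoint.

Lemma krull_dim_chain (A : comNzRingType) d : krull_dim A d ->
  (exists P, chain (@proper A) (@is_prime A) d P) /\
  forall P, ~ chain (@proper A) (@is_prime A) d.+1 P.
Proof.
move=> /longest_chainP[_ h]; split.
  have [P cP] := (h d).2 (lexx _); exists P; apply: chain_sub cP => _ [Q _ <-].
  exact: prime_idealr_prime.
move=> P cP; suff : (d.+1%:Z <= d%:Z) by lia.
apply/h; exists P; apply: chain_sub cP => Q /mk_prime[K eK]; by exists K.
Qed.

(** * Closed points against integrally closed ideals of colength one, and the dimension of Proj *)

Theorem proposition3p1 (A : comNzRingType) (m I : idealr A) (d : nat)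
    (A_noetherian : noetherian A)
    (A_local : local_with m)
    (k_closed : GRing.closed_field_axiom {ideal_quot m})
    (dim_A : krull_dim A d)
    (I_primary : primary_to m I)
    (I_closed : integrally_closed_ideal I) :
  set_bij
    [set I' : idealr A | [/\ integrally_closed_ideal I', {subset I' <= I} &
                             module_length (ideal_quotient I I') 1]]
    [set [set` (P : prime_idealr (fiber_cone m I))]
       | P in [set P : Proj (fiber_cone m I) | closed [set P]]]
    (@cone_point A m I)
  /\ top_dim (Proj (fiber_cone m I)) (d%:Z - 1).
Proof.
have nA := noetherian_noeth A_noetherian; have [_ mI] := I_primary.
have point (J : idealr A) : integrally_closed_ideal J -> {subset J <= I} ->
    module_length (ideal_quotient I J) 1 ->
    [/\ ideal_mul [set` m] [set` I] `<=` [set` J], gpoint m I (cone_forms m I [set` J]) &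
      forall Q, gpoint m I Q -> cone_forms m I [set` J] `<=` Q -> Q = cone_forms m I [set` J]].
  move=> clJ JI /(colength1_adjoin nA A_local JI)[[z zI zJ] mIJ Jz].
  have IJz := Jz z zI zJ; have idJ := idealr_ideal J.
  suff [] : gpoint m I (cone_forms m I [set` J]) /\ forall Q, gpoint m I Q ->
    cone_forms m I [set` J] `<=` Q -> Q = cone_forms m I [set` J] by [].
  apply: (cone_forms_gpoint nA A_local idJ JI mIJ zI IJz) => n.
  by move=> /(cone_forms_integral idJ IJz) /clJ; apply/negP.
split; last first.
  have [[P0 cP0] noP] := krull_dim_chain dim_A.
  apply: top_dim_gpoint => [|n]; first by lia.
  have -> : (n%:Z <= d%:Z - 1) = (n < d)%N by lia.
  split=> [[Q cQ]|nd]; first exact: (gpoint_chain_lt nA A_local mI noP cQ).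
  (* Were there no chain of length n in Proj, all chains of primes of [A] would have length at most
     n, less than d. *)
  apply: contrapT => noQ; have := prime_chain_le nA A_local mI _ cP0.
  move=> /(_ n) h; have := h (fun Q cQ => noQ (ex_intro _ Q cQ)); rewrite leqNgt nd.
  by [].
split.
- move=> J [clJ JI lenJ]; have [mIJ pF maxF] := point J clJ JI lenJ.
  have [P [eP fP]] := gpoint_proj pF; exists P.
    by apply/(closed_pointP) => Q QQ; rewrite fP; apply: maxF.
  by rewrite (cone_pointE JI mIJ pF) -eP.
- move=> J K /set_mem[clJ JI lenJ] /set_mem[clK KI lenK].
  have [mIJ pJ _] := point J clJ JI lenJ; have [mIK pK _] := point K clK KI lenK.
  rewrite (cone_pointE JI mIJ pJ) (cone_pointE KI mIK pK) => e.
  have {}e : cone_forms m I [set` J] = cone_forms m I [set` K].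
    have [[_ zJ _] [_ zK _]] := (pJ, pK).
    rewrite -(of_formsK (gpoint_graded pJ) zJ) e of_formsK //; exact: gpoint_graded pK.
  apply: idealr_inj; rewrite -(cone_forms1 m I (idealr_ideal J)) e.
  exact/cone_forms1/idealr_ideal.
- move=> _ [P /closed_pointP maxP <-].
  have pP := forms_gpoint P; set F := forms (pset P) in maxP pP.
  have gF := gpoint_graded pP; have [idF FI FM] := gF; have [_ zF [z Iz nFz]] := pP.
  have F1I : slice F 1 `<=` [set` I].
    by move=> x /FI; rewrite /= -[ideal_mul _ _]/(ideal_pow [set` I] 1) ideal_pow1 //;
      apply: idealr_ideal.
  have nF1 : ~ slice F 1 1 by move=> /F1I; rewrite /= idealr1.
  (* The inverse map sends a closed point to its degree one part, read as an ideal between mI and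
     I. *)
  have [J eJ] := mk_idealr (idF 1%N) nF1.
  have JI : {subset J <= I} by move=> x xJ; apply: F1I; rewrite -eJ.
  have zJ : z \notin J by apply/negP => zJ; apply: nFz; have : [set` J] z by []; rewrite eJ.
  have mIJ : ideal_mul [set` m] [set` I] `<=` [set` J].
    by rewrite eJ -[X in ideal_mul _ X](ideal_pow1 (idealr_ideal I)) => x; exact: (zF (1%N, x)).
  have IJz : [set` I] `<=` adjoin [set` J] z.
    move=> s Is; have [c Fc] := maximal_gpoint_line nA A_local k_closed pP maxP Is Iz nFz.
    by apply/adjoinP; exists (s - c * z); [rewrite eJ|exists c; rewrite subrK].
  have subF : cone_forms m I [set` J] `<=` F.
    move=> [[|n] a] /=; rewrite /cone_forms /=; first by move/(gpoint0 nA A_local a pP).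
    have -> : F (n.+1, a) = slice F n.+1 a by [].
    move: a; apply: ideal_mul_le => // x y; rewrite eJ => Fx Iy.
    by rewrite /slice /= -[n.+1]add1n; apply: FM.
  have [pJ maxJ] : gpoint m I (cone_forms m I [set` J]) /\ forall Q, gpoint m I Q ->
      cone_forms m I [set` J] `<=` Q -> Q = cone_forms m I [set` J].
    apply: (cone_forms_gpoint nA A_local (idealr_ideal J) JI mIJ Iz IJz) => n Fzn.
    apply: nFz; apply: (gpoint_exp pP (k := n)); first exact: ideal_pow1_mem.
    by rewrite muln1; exact: subF.
  (* WR is contained in the given point and is already maximal among points, so a closed point is
     generated in degree one. *)
  have eF := maxJ F pP subF.
  exists J; last by rewrite (cone_pointE JI mIJ pJ) -eF -pset_forms.
  split=> //; last exact: (adjoin_colength1 (m := m) nA A_local JI Iz zJ mIJ IJz).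
  move=> x; rewrite eJ => hx.
  have : slice F 1 x by apply: (slice_integrally_closed I_closed pP).
  by rewrite -eJ.
Qed.
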